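(* Let $n\geq 3$, $\alpha\in(0,n)$, $\sigma_1,\sigma_2\in[0,\alpha)$, and suppose $q\geq p>1$ and $\sigma_1\geq\sigma_2$, and that $q_0+p_0\leq n-\alpha$. If $u,v$ are positive integrable solutions of $$u(x)=\int_{\mathbb{R}^n}\frac{v(y)^q}{|x-y|^{n-\alpha}|y|^{\sigma_1}}\,dy,\qquad v(x)=\int_{\mathbb{R}^n}\frac{u(y)^p}{|x-y|^{n-\alpha}|y|^{\sigma_2}}\,dy,\qquad x\in\mathbb{R}^n,$$ then $(u,v)\in L^r(\mathbb{R}^n)\times L^s(\mathbb{R}^n)$ for every pair $(r,s)$ with $$\frac1r\in\Big(0,\frac{n-\alpha}{n}\Big)\quad\text{and}\quad\frac1s\in\Big(0,\min\Big\{\frac{n-\alpha}{n},\frac{p(n-\alpha)-(\alpha-\sigma_2)}{n}\Big\}\Big).$$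
   Context: Define $$p_0=\frac{\alpha(1+p)-(\sigma_2+\sigma_1p)}{pq-1},\qquad q_0=\frac{\alpha(1+q)-(\sigma_1+\sigma_2q)}{pq-1},\qquad r_0=\frac{n}{q_0},\qquad s_0=\frac{n}{p_0}.$$ A positive solution $u,v$ is integrable if $u\in L^{r_0}(\mathbb{R}^n)$ and $v\in L^{s_0}(\mathbb{R}^n)$. The condition $q_0+p_0\leq n-\alpha$ is equivalent to $\frac{n-\sigma_1}{1+q}+\frac{n-\sigma_2}{1+p}\leq n-\alpha$. *)

(* Defs.v *)
From HB Require Import structures.
From mathcomp Require Import all_boot all_order all_algebra.
From mathcomp Require Import all_classical all_reals all_analysis.
Set Implicit Arguments. Unset Strict Implicit. Unset Printing Implicit Defensive.
Import Order.TTheory GRing.Theory Num.Theory.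
Local Open Scope classical_set_scope.
Local Open Scope ring_scope.

(* Points of R^n are n-tuples of reals; n.-tuple R carries the product
   (= Borel) sigma-algebra from mathcomp-analysis. *)
Section Rn.
Variable R : realType.

Definition enorm n (x : n.-tuple R) : R :=
  Num.sqrt (\sum_(i < n) (tnth x i) ^+ 2).

Definition tsub n (x y : n.-tuple R) : n.-tuple R :=
  [tuple tnth x i - tnth y i | i < n].

(* Lebesgue integral over R^n of a (nonnegative, measurable) extended-real
   function, as the iterated one-dimensional Lebesgue integral
   (equal to the integral against n-dimensional Lebesgue measure by Tonelli). *)
Fixpoint intRn (n : nat) : (n.-tuple R -> \bar R) -> \bar R :=
  match n with
  | 0 => fun f => f [tuple]
  | m.+1 => fun f =>
      (\int[@lebesgue_measure R]_x intRn (fun t : m.-tuple R => f [tuple of x :: t]))%E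
  end.

Definition inLp n (r : R) (f : n.-tuple R -> R) : Prop :=
  measurable_fun setT f /\ (intRn (fun x => (`|f x| `^ r)%:E) < +oo)%E.

Definition whls n (a sig e : R) (g : n.-tuple R -> R) (x : n.-tuple R) : \bar R :=
  intRn (fun y => ((g y) `^ e / ((enorm (tsub x y)) `^ (n%:R - a) * (enorm y) `^ sig))%:E).

Definition p0 (a s1 s2 p q : R) : R := (a * (1 + p) - (s2 + s1 * p)) / (p * q - 1).
Definition q0 (a s1 s2 p q : R) : R := (a * (1 + q) - (s1 + s2 * q)) / (p * q - 1).

End Rn.

(* Main.v *)
(* The weighted Riesz kernel is dominated almost everywhere by the tensor product
   of one-dimensional kernels |x_i - y_i|^(-lam) |y_i|^(-tau), lam = 1 - a/n and
   tau = s/n, because |x| >= |x_i|. A bilinear bound L^P x L^m -> R tensorizes, so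
   the weighted Hardy-Littlewood-Sobolev inequality on R^n follows from the one on
   R. The latter splits into an unweighted part and a Hardy part on |y| <= |x|, and
   both follow from pointwise inequalities for f(x) k(x, y) g(y) whose terms are
   integrated in one variable at a time. By duality the integral operators map
   L^(n/(X + a - s)) to L^(n/X) for every X in (0, n - a).

   Writing X = n/r and Y = n/s, the map w |-> K1 (v^(q-1) K2 (u^(p-1) w)) acts on
   L^(n/X) for every X in (q0 - p0, n - a), in particular for X = q0. Cutting v off
   where it is very large or very small makes it a contraction S for both X and q0,
   with u = S u + F and F in L^(n/X); summing the Neumann series gives u in L^(n/X).
   One application of the second equation gives all Y, since Y = p X - (a - s2), and
   one application of the first equation then gives the remaining X <= q0 - p0. *)

Require Import Defs.
From HB Require Import structures.
From mathcomp Require Import all_boot all_order all_algebra.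
From mathcomp Require Import all_classical all_reals all_analysis.
From mathcomp Require Import measurable_realfun measurable_fun_approximation.
From mathcomp Require Import ring lra.
Set Implicit Arguments. Unset Strict Implicit. Unset Printing Implicit Defensive.
Import Order.TTheory GRing.Theory Num.Theory.
Import numFieldNormedType.Exports.
Local Open Scope classical_set_scope.
Local Open Scope ring_scope.

(** * Nonnegative measurable functions *)

Section NonnegativeMeasurable.
Local Open Scope ereal_scope.
Context {R : realType}.

(** The scaling relation 1/P + 1/m + (n - a)/n + s/n = 2 on R^n is literally the one on the line for
    lam and tau, so tensorizing loses no exponents.

    In the variables X and Y, multiplication by u^(p-1) adds (p - 1) q0 and K2 subtracts a - s2;
    since p q0 = p0 + (a - s2), together they send X to X - (q0 - p0). Multiplication by v^(q-1)
    followed by K1 sends this back to X, because q p0 = q0 + (a - s1). The intermediate exponent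
    must be positive, whence the lower end q0 - p0. The hypothesis q0 + p0 <= n - a puts q0 and p0
    inside (0, n - a), so the known integrability can start the lifting.

    The obstacle is that the L^(n/X) norm of u may be infinite, so S u cannot be absorbed into the
    left-hand side of u = S u + F; the contraction at the exponent q0, where the norm is finite,
    replaces the absorption. For the same reason functions take values in [0, +oo] and norm
    inequalities are stated without integrability assumptions. *)

Definition nnm d (T : measurableType d) (f : T -> \bar R) :=
  measurable_fun setT f /\ forall x, 0 <= f x.

Lemma nnm_comp d1 d2 (T1 : measurableType d1) (T2 : measurableType d2)
    (h : T1 -> T2) (f : T2 -> \bar R) :
  measurable_fun setT h -> nnm f -> nnm (fun x => f (h x)).
Proof. by move=> mh [mf f0]; split=> //; exact: measurableT_comp. Qed.

Context d (T : measurableType d).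
Implicit Types f g : T -> \bar R.

Lemma nnmM f g : nnm f -> nnm g -> nnm (fun x => f x * g x).
Proof.
by move=> [mf f0] [mg g0]; split=> [|x]; [exact: emeasurable_funM|exact: mule_ge0].
Qed.

Lemma nnmD f g : nnm f -> nnm g -> nnm (fun x => f x + g x).
Proof.
by move=> [mf f0] [mg g0]; split=> [|x]; [exact: emeasurable_funD|exact: adde_ge0].
Qed.

Lemma nnm_cst (c : \bar R) : 0 <= c -> nnm (fun _ : T => c).
Proof. by split=> // *; exact: measurable_cst. Qed.

Lemma nnm_poweR f r : nnm f -> nnm (fun x => f x `^ r).
Proof.
move=> [mf f0]; split=> [|x]; last exact: poweR_ge0.
by apply: (measurableT_comp (measurable_poweR _)).
Qed.

Lemma nnm_EFin (h : T -> R) : measurable_fun setT h -> (forall x, (0 <= h x)%R) ->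
  nnm (fun x => (h x)%:E).
Proof. by move=> mh h0; split=> [|x]; [exact/measurable_EFinP|rewrite lee_fin]. Qed.

Variable mu : {measure set T -> \bar R}.

Lemma nnm_le_integral f g : nnm f -> nnm g -> (forall x, f x <= g x) ->
  \int[mu]_x f x <= \int[mu]_x g x.
Proof. by move=> [mf f0] [mg g0] fg; apply: ge0_le_integral. Qed.

Lemma nnm_integralD f g : nnm f -> nnm g ->
  \int[mu]_x (f x + g x) = \int[mu]_x f x + \int[mu]_x g x.
Proof. by move=> [mf f0] [mg g0]; rewrite ge0_integralD. Qed.

Lemma nnm_integralZl f (c : \bar R) : nnm f -> 0 <= c ->
  \int[mu]_x (c * f x) = c * \int[mu]_x f x.
Proof. by move=> [mf f0] c0; rewrite ge0_integralZl. Qed.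

Lemma nnm_integralZr f (c : \bar R) : nnm f -> 0 <= c ->
  \int[mu]_x (f x * c) = (\int[mu]_x f x) * c.
Proof. by move=> [mf f0] c0; rewrite ge0_integralZr. Qed.

Lemma nnm_integral_ge0 f : nnm f -> 0 <= \int[mu]_x f x.
Proof. by move=> [_ f0]; exact: integral_ge0. Qed.

Lemma integral_poweR_eq0 f g (p : R) : p != 0%R -> nnm f -> nnm g ->
  \int[mu]_x f x `^ p = 0 -> \int[mu]_x (f x * g x) = 0.
Proof.
move=> p0 nf ng If0; have [mf f0] := nf; have [mg g0] := ng.
have [mfp fp0] := nnm_poweR p nf.
have : \int[mu]_x `|f x `^ p| = 0.
  by rewrite -If0; apply: eq_integral => x _; rewrite gee0_abs.
move/(ae_eq_integral_abs mu measurableT mfp) => fae.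
transitivity (\int[mu]_x cst 0 x); last by rewrite integral0.
apply: ge0_ae_eq_integral => //; first exact: emeasurable_funM.
  by move=> x _; exact: mule_ge0.
move: fae; apply: filterS => x /(_ I) /= /(poweR_eq0_eq0 (f0 x)) fx0 _ /=.
by rewrite fx0 mul0e.
Qed.

Lemma nnm_integral_bigcup_le (E : (set T)^nat) f (C : \bar R) :
  nondecreasing_seq E -> (forall n, measurable (E n)) -> nnm f ->
  (forall n, \int[mu]_(x in E n) f x <= C) ->
  \int[mu]_(x in \bigcup_n E n) f x <= C.
Proof.
move=> ndE mE [mf f0] fC.
have cv : \int[mu]_(x in E i) f x @[i --> \oo] --> \int[mu]_(x in \bigcup_i E i) f x.
  by apply: ge0_nondecreasing_set_cvg_integral => // i; exact: measurable_funTS.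
rewrite -(cvg_lim _ cv)//; apply: lime_le; first by apply/cvg_ex; eexists; exact: cv.
exact: nearW.
Qed.

(** Scaling f to unit norm leaves two degenerate cases: zero norm, treated by a hypothesis, and
    infinite norm, trivial because C > 0. The constant C is an extended real since for a bilinear
    form it contains the norm of the other argument. *)
Lemma homogeneous_le (J : (T -> \bar R) -> \bar R) (p : R) (C : \bar R) :
  (0 < p)%R -> 0 < C ->
  (forall f (c : R), nnm f -> (0 < c)%R -> J (fun x => c%:E * f x) = c%:E * J f) ->
  (forall f, nnm f -> \int[mu]_x f x `^ p = 0 -> J f = 0) ->
  (forall f, nnm f -> \int[mu]_x f x `^ p = 1 -> J f <= C) ->
  forall f, nnm f -> J f <= C * (\int[mu]_x f x `^ p) `^ p^-1.
Proof.
move=> p0 C0 JZ J0 J1 f nf.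
have pN0 : p != 0%R by rewrite gt_eqF.
have := nnm_integral_ge0 (nnm_poweR p nf).
case E : (\int[mu]_x f x `^ p) => [s| |] // s0; last first.
  by rewrite poweRyr ?invr_neq0// gt0_muley ?leey.
move: s0; rewrite lee_fin le_eqVlt => /predU1P[s0|s0].
  by rewrite J0 ?E -?s0// mule_ge0 ?poweR_ge0// ltW.
pose c := (s `^ p^-1)%R.
have c0 : (0 < c)%R by rewrite powR_gt0.
pose g x := (c^-1)%:E * f x.
have ng : nnm g by apply: nnmM => //; apply: nnm_cst; rewrite lee_fin invr_ge0 ltW.
have -> : f = fun x => c%:E * g x.
  by apply/funext => x; rewrite /g muleA -EFinM divff ?gt_eqF// mul1e.
rewrite JZ// muleC poweR_EFin lee_pmul2r ?lte_fin//; apply: J1 => //.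
transitivity (\int[mu]_x (s^-1%:E * f x `^ p)).
  apply: eq_integral => x _; rewrite /g poweRM ?lee_fin ?invr_ge0 ?(ltW c0)//; last by case: nf.
  by rewrite poweR_EFin -powR_inv1 ?(ltW c0)// /c -!powRrM mulN1r mulrN mulVf// powR_inv1 ?(ltW s0).
rewrite nnm_integralZl ?lee_fin ?invr_ge0 ?(ltW s0)//; last exact: nnm_poweR.
by rewrite E -EFinM mulVf// gt_eqF.
Qed.

Lemma nnm_young f g (p q : R) : (0 < p)%R -> (0 < q)%R -> (p^-1 + q^-1 = 1)%R ->
  nnm f -> nnm g ->
  forall x, f x * g x <= p^-1%:E * f x `^ p + q^-1%:E * g x `^ q.
Proof.
move=> p0 q0 pq [_ f0] [_ g0] x.
move: (f0 x) (g0 x); case: (f x) => [a| |]// + ; case: (g x) => [b| |]//.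
- rewrite !lee_fin => a0 b0.
  by have := conjugate_powR a0 b0 p0 q0 pq; rewrite ![(_ / _)%R]mulrC.
- move=> a0 _; rewrite (@poweRyr _ q) ?gt_eqF// (gt0_muley (x := q^-1%:E)) ?lte_fin ?invr_gt0//.
  by rewrite addey ?leey// mule_neq0_Ny//.
- move=> _ b0; rewrite (@poweRyr _ p) ?gt_eqF// (gt0_muley (x := p^-1%:E)) ?lte_fin ?invr_gt0//.
  by rewrite addye ?leey//.
- by rewrite !poweRyr ?gt_eqF// !gt0_muley ?lte_fin ?invr_gt0// addye ?leey.
Qed.

(** For unit norms this is the integral of Young's inequality; [homogeneous_le] in each argument
    removes the normalization. *)
Lemma nnm_hoelder f g (p q : R) : (0 < p)%R -> (0 < q)%R -> (p^-1 + q^-1 = 1)%R ->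
  nnm f -> nnm g ->
  \int[mu]_x (f x * g x) <=
    (\int[mu]_x f x `^ p) `^ p^-1 * (\int[mu]_x g x `^ q) `^ q^-1.
Proof.
move=> p0 q0 pq nf ng.
have pN0 : p != 0%R by rewrite gt_eqF.
have qN0 : q != 0%R by rewrite gt_eqF.
have unit_bound f' g' : nnm f' -> nnm g' -> \int[mu]_x f' x `^ p = 1 ->
    \int[mu]_x g' x `^ q = 1 -> \int[mu]_x (f' x * g' x) <= 1.
  move=> nf' ng' f1 g1; have nfp := nnm_poweR p nf'; have ngq := nnm_poweR q ng'.
  have p1 : 0 <= (p^-1)%:E by rewrite lee_fin invr_ge0 ltW.
  have q1 : 0 <= (q^-1)%:E by rewrite lee_fin invr_ge0 ltW.
  apply: (@le_trans _ _ (\int[mu]_x (p^-1%:E * f' x `^ p + q^-1%:E * g' x `^ q))).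
    apply: nnm_le_integral; first exact: nnmM.
      by apply: nnmD; apply: nnmM => //; exact: nnm_cst.
    exact: nnm_young.
  rewrite nnm_integralD; [|by apply: nnmM => //; exact: nnm_cst..].
  by rewrite !nnm_integralZl// f1 g1 !mule1 -EFinD pq.
have hZ h f' (c : R) : nnm h -> nnm f' -> (0 < c)%R ->
    \int[mu]_x (c%:E * f' x * h x) = c%:E * \int[mu]_x (f' x * h x).
  move=> nh nf' c0; rewrite -nnm_integralZl ?lee_fin 1?ltW//; last exact: nnmM.
  by apply: eq_integral => x _; rewrite muleA.
(* The norm of g is going to be the constant in [homogeneous_le] and must be positive. *)
have [g0|g0] := eqVneq (\int[mu]_x g x `^ q) 0.
  under eq_integral do rewrite muleC.
  by rewrite (integral_poweR_eq0 qN0 ng nf g0) mule_ge0 ?poweR_ge0.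
rewrite muleC; apply: (@homogeneous_le (fun f => \int[mu]_x (f x * g x)) p) => //.
- by rewrite poweR_gt0// lt0e g0; apply: nnm_integral_ge0; exact: nnm_poweR.
- by move=> f' c nf' c0; exact: hZ.
- by move=> f' nf' f'0; exact: integral_poweR_eq0 f'0.
- move=> f' nf' f1; under eq_integral do rewrite muleC.
  rewrite -[leRHS]mul1e.
  apply: (@homogeneous_le (fun g => \int[mu]_x (g x * f' x)) q) => //.
  + by move=> g' c ng' c0; exact: hZ.
  + by move=> g' ng' g'0; exact: integral_poweR_eq0 g'0.
  + by move=> g' ng' g1; under eq_integral do rewrite muleC; exact: unit_bound.
Qed.

End NonnegativeMeasurable.

(** * Power integrals on the line *)

Section PowerIntegrals.
Context {R : realType}.
Notation mu := (@lebesgue_measure R).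
Implicit Types (a b e : R).

Lemma measurable_powR_comp d (T : measurableType d) (h : T -> R) e :
  measurable_fun setT h -> measurable_fun setT (fun x => h x `^ e).
Proof. exact: (measurableT_comp (measurable_powR e)). Qed.

Lemma continuous_powR e x : 0 < x -> {for x, continuous (fun t : R => t `^ e)}.
Proof.
move=> x0; apply: differentiable_continuous; apply/derivable1_diffP.
by apply: derivable_powR; rewrite in_itv/= andbT.
Qed.

Lemma integral_powR_itvcc a b e : 0 < a -> a < b -> e != 1 ->
  (\int[mu]_(x in `[a, b]) (x `^ (- e))%:E)%E =
  ((b `^ (1 - e) - a `^ (1 - e)) / (1 - e))%:E.
Proof.
move=> a0 ab e1.
have e10 : 1 - e != 0 by rewrite subr_eq0 eq_sym.
rewrite (@continuous_FTC2 _ _ (fun t => t `^ (1 - e) / (1 - e))) //.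
- by rewrite -EFinB mulrBl.
- apply: continuous_in_subspaceT => x; rewrite inE/= in_itv/= => /andP[ax _].
  by apply: continuous_powR; exact: lt_le_trans ax.
- have cF x : 0 < x -> {for x, continuous (fun t : R => t `^ (1 - e) / (1 - e))}.
    by move=> x0; apply: cvgM; [exact: continuous_powR|exact: cvg_cst].
  split.
  + move=> x; rewrite in_itv/= => /andP[ax _].
    apply: derivableM; last exact: derivable_cst.
    by apply: derivable_powR; rewrite in_itv/= andbT (lt_trans a0).
  + by apply: cvg_at_right_filter; exact: cF.
  + by apply: cvg_at_left_filter; apply: cF; exact: lt_trans ab.
- move=> x; rewrite in_itv/= => /andP[ax _]; have x0 := lt_trans a0 ax.
  rewrite derive1E deriveM//; last first.
    by apply: derivable_powR; rewrite in_itv/= andbT.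
  rewrite derive_cst scaler0 add0r -derive1E powR_derive1; last by rewrite in_itv/= andbT.
  rewrite /GRing.scale/= mulrA mulVf// mul1r; congr (_ `^ _); lra.
Qed.

Lemma nnm_powR e : nnm (fun t : R => (t `^ e)%:E).
Proof. by apply: nnm_EFin => [|x]; rewrite ?powR_ge0//; exact: measurable_powR. Qed.

Lemma integral_powR_near0_le e b : e < 1 -> 0 < b ->
  (\int[mu]_(x in `]0%R, b]) (x `^ (- e))%:E <= (b `^ (1 - e) / (1 - e))%:E)%E.
Proof.
move=> e1 b0.
have e10 : 0 < 1 - e by lra.
(* The denominator n + 2 keeps the left end strictly below b even for n = 0, as
   [integral_powR_itvcc] requires. *)
have -> : `]0%R, b]%classic = \bigcup_n `[b / n.+2%:R, b]%classic.
  apply/seteqP; split=> x /=.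
    rewrite in_itv/= => /andP[x0 xb].
    have [n nx] : exists n : nat, b / x < n%:R.
      by exists (Num.truncn (b / x)).+1; rewrite truncnS_gt.
    exists n => //=; rewrite in_itv/= xb andbT ler_pdivrMr// -ler_pdivrMl// mulrC.
    by rewrite (le_trans (ltW nx))// ler_nat -addn2 leq_addr.
  move=> [n _] /=; rewrite !in_itv/= => /andP[bx ->]; rewrite andbT.
  by apply: lt_le_trans bx; rewrite divr_gt0.
apply: nnm_integral_bigcup_le => //.
- move=> i j ij; apply/subsetPset => x /=; rewrite !in_itv/= => /andP[bx ->].
  rewrite andbT; apply: le_trans bx; rewrite ler_pM2l// lef_pV2 ?posrE// ler_nat.
  by rewrite !ltnS.
- exact: nnm_powR.
- move=> n; rewrite integral_powR_itvcc ?divr_gt0//.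
  + rewrite lee_fin ler_pM2r ?invr_gt0//; have := powR_ge0 (b / n.+2%:R) (1 - e); lra.
  + by rewrite gtr_pMr// invf_lt1 ?ltr1n.
  + by rewrite lt_eqF.
Qed.

Lemma integral_powR_infty_le e a : 1 < e -> 0 < a ->
  (\int[mu]_(x in `[a, +oo[) (x `^ (- e))%:E <= (a `^ (1 - e) / (e - 1))%:E)%E.
Proof.
move=> e1 a0.
have e10 : 0 < e - 1 by lra.
have -> : `[a, +oo[%classic = \bigcup_n `[a, a + n.+1%:R]%classic.
  apply/seteqP; split=> x /=.
    rewrite in_itv/= andbT => ax.
    exists (Num.truncn (x - a)) => //=; rewrite in_itv/= ax/= -lerBlDl.
    by rewrite ltW// truncnS_gt.
  by move=> [n _] /=; rewrite !in_itv/= => /andP[-> _].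
apply: nnm_integral_bigcup_le => //.
- move=> i j ij; apply/subsetPset => x /=; rewrite !in_itv/= => /andP[-> bx] /=.
  by rewrite (le_trans bx)// lerD2l ler_nat ltnS.
- exact: nnm_powR.
- move=> n; rewrite integral_powR_itvcc ?ltrDl ?ltr0Sn// ?gt_eqF//.
  rewrite lee_fin -[1 - e]opprB invrN mulrN -mulNr ler_pM2r ?invr_gt0//.
  by have := powR_ge0 (a + n.+1%:R) (- (e - 1)); lra.
Qed.

Lemma pushforward_lebesgue_shift y (A : set R) : measurable A ->
  pushforward mu ((fun x => x - y) : _ -> measurableTypeR R) A = mu A.
Proof.
move=> mA; apply/esym.
have mf : measurable_fun setT ((fun x => x - y) : measurableTypeR R -> measurableTypeR R).
  exact: measurable_funB.
apply: (@lebesgue_measure_unique _ (pushforward mu _)) => //= _ [[a b]] _ <-.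
rewrite /pushforward /= (_ : _ @^-1` _ = `]a + y, b + y]%classic); last first.
  by apply/seteqP; split=> x /=; rewrite !in_itv/= ltrBrDr lerBlDr.
rewrite !lebesgue_measure_itv/= !lte_fin ltrD2r; case: ifP => // _.
by congr EFin; ring.
Qed.

Lemma integral_shift (h : R -> \bar R) y : nnm h ->
  (\int[mu]_x h (x - y)%R = \int[mu]_x h x)%E.
Proof.
move=> [mh h0].
have mf : measurable_fun setT ((fun x => x - y) : measurableTypeR R -> measurableTypeR R).
  exact: measurable_funB.
transitivity (\int[pushforward mu ((fun x => x - y)%R : _ -> measurableTypeR R)]_x h x)%E.
  by rewrite ge0_integral_pushforward.
by apply: eq_measure_integral => A mA _; exact: pushforward_lebesgue_shift.
Qed.

Lemma integral_normr (h : R -> \bar R) : nnm h ->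
  (\int[mu]_x h `|x|%R = 2%:E * \int[mu]_(x in `[0%R, +oo[) h x)%E.
Proof.
move=> [mh h0].
have mhn : measurable_fun setT (fun x : R => h `|x|) by exact: measurableT_comp.
rewrite -(setUv (`[0%R, +oo[%classic : set R)) ge0_integral_setU//=.
- rewrite mule_natl mule2n; congr (_ + _)%E.
    by apply: eq_integral => x; rewrite inE/= in_itv/= andbT => x0; rewrite ger0_norm.
  rewrite setCitvr integral_itv_bndo_bndc; last exact: measurable_funTS.
  rewrite ge0_integration_by_substitution0//.
  by apply: eq_integral => x; rewrite inE/= in_itv/= => x0; rewrite ler0_norm.
- exact: measurableC.
- by rewrite setUv.
- exact/disj_setPCl.
Qed.

End PowerIntegrals.

(** * Pointwise inequalities for real powers *)

Section RealInequalities.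
Context {R : realType}.
Implicit Types (a b c d e P m lam tau x y X Y : R).

Lemma ge0_ler_powRN e a b : 0 <= e -> 0 < a -> a <= b -> b `^ (- e) <= a `^ (- e).
Proof.
move=> e0 a0 ab; rewrite !powRN lef_pV2 ?posrE ?powR_gt0 ?(lt_le_trans a0)//.
by rewrite ge0_ler_powR ?nnegrE// ?ltW// (lt_le_trans a0).
Qed.

Lemma powR_oppVK a e : 0 < a -> e != 0 -> (a `^ (- e)) `^ (- e^-1) = a.
Proof. by move=> a0 e0; rewrite -powRrM mulrNN mulfV// powRr1// ltW. Qed.

(** A crude weighted AM-GM inequality: with S the sum, each factor is at most S^ti, and the
    exponents add up to 1. *)
Lemma prod_powR_le_sum (u0 u1 u2 t0 t1 t2 : R) : 0 < u0 -> 0 < u1 -> 0 < u2 ->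
  0 <= t0 -> 0 <= t1 -> 0 <= t2 -> t0 + t1 + t2 = 1 ->
  u0 `^ t0 * u1 `^ t1 * u2 `^ t2 <= u0 + u1 + u2.
Proof.
move=> u00 u10 u20 t00 t10 t20 t1E; set S := u0 + u1 + u2.
have S0 : 0 < S by rewrite /S; lra.
have -> : S = S `^ t0 * S `^ t1 * S `^ t2.
  by rewrite -!powRD ?t1E ?powRr1 ?ltW// (gt_eqF S0) implybT.
have le_S u t : 0 < u -> u <= S -> 0 <= t -> u `^ t <= S `^ t.
  by move=> u_gt0 uS t_ge0; rewrite ge0_ler_powR ?nnegrE// ltW.
by rewrite !ler_pM ?mulr_ge0 ?powR_ge0 ?le_S// /S; lra.
Qed.

(** This is b times the kernel d^(-lam), with the other function replaced by max(b^(-m), d)^(-e).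
    When e + lam + 1/m = 2, its integral in d is a multiple of b^m: with B = b^(-m), both d < B and
    d > B contribute a multiple of b B^(1 - e - lam) = b^m. *)
Definition level_term m e lam b d := b * (Num.max (b `^ (- m)) d `^ (- e) * d `^ (- lam)).

Lemma le_sum3 (z t1 t2 t3 : R) : 0 <= t1 -> 0 <= t2 -> 0 <= t3 ->
  [|| z <= t1, z <= t2 | z <= t3] -> z <= t1 + t2 + t3.
Proof. by move=> ? ? ? /or3P[] ?; lra. Qed.

(* With A = a^(-P) and B = b^(-m), whose reciprocals have integral 1, the term
   on the right-hand side that dominates is given by the largest of A, B and d. *)
Lemma product_le_level_terms P m lam a b d : 1 < P -> 1 < m ->
  P^-1 + m^-1 + lam = 2 -> 0 < lam -> 0 < a -> 0 < b -> 0 < d ->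
  a * (d `^ (- lam) * b) <=
  level_term P m^-1 lam a d + level_term m P^-1 lam b d + a `^ P * b `^ m.
Proof.
move=> P1 m1 Pml lam0 a0 b0 d0; rewrite /level_term.
have lamE : lam = (1 - P^-1) + (1 - m^-1) by lra.
have P0 : 0 < P by lra.
have m0 : 0 < m by lra.
have PN0 : P != 0 by rewrite gt_eqF.
have mN0 : m != 0 by rewrite gt_eqF.
have dl0 : 0 <= d `^ (- lam) by exact: powR_ge0.
set A := a `^ (- P); set B := b `^ (- m).
have A0 : 0 < A by exact: powR_gt0.
have B0 : 0 < B by exact: powR_gt0.
have aE : a = A `^ (- P^-1) by rewrite powR_oppVK.
have bE : b = B `^ (- m^-1) by rewrite powR_oppVK.
have T1 : 0 <= a * (Num.max A d `^ (- m^-1) * d `^ (- lam)).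
  by rewrite !mulr_ge0 ?powR_ge0// ltW.
have T2 : 0 <= b * (Num.max B d `^ (- P^-1) * d `^ (- lam)).
  by rewrite !mulr_ge0 ?powR_ge0// ltW.
have T3 : 0 <= a `^ P * b `^ m by rewrite mulr_ge0 ?powR_ge0.
apply: (le_sum3 T1 T2 T3); apply/or3P; clear T1 T2 T3.
have [Ad|] := boolP (A <= d); last first.
  rewrite -ltNge => dA.
  have [BA|] := boolP (B <= A).
    apply: Or32.
    have -> : a * (d `^ (- lam) * b) = b * (a * d `^ (- lam)) by ring.
    rewrite ler_wpM2l ?(ltW b0)// ler_wpM2r// [X in X <= _]aE.
    by apply: ge0_ler_powRN; rewrite ?invr_ge0 ?(ltW P0)// ?lt_max ?B0// ge_max BA (ltW dA).
  rewrite -ltNge => AB.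
  apply: Or31.
  rewrite ler_wpM2l ?(ltW a0)// mulrC ler_wpM2r// [X in X <= _]bE.
  by apply: ge0_ler_powRN; rewrite ?invr_ge0 ?(ltW m0)// ?lt_max ?A0// ge_max (ltW AB) (ltW (lt_trans dA AB)).
have [Bd|] := boolP (B <= d); last first.
  rewrite -ltNge => dB.
  apply: Or31.
  rewrite ler_wpM2l ?(ltW a0)// mulrC ler_wpM2r// [X in X <= _]bE.
  by apply: ge0_ler_powRN; rewrite ?invr_ge0 ?(ltW m0)// ?lt_max ?A0// ge_max (ltW dB) (ltW (le_lt_trans Ad dB)).
(* Here A, B <= d, and lam is the sum of the positive exponents 1 - 1/P and 1 - 1/m, so d^lam
   dominates the two powers. The factor of a b that is left is 1/(A B) = a^P b^m. *)
apply: Or33.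
have iP : P^-1 < 1 by rewrite invf_lt1.
have im : m^-1 < 1 by rewrite invf_lt1.
have -> : a `^ P = A^-1 by rewrite /A powRN invrK.
have -> : b `^ m = B^-1 by rewrite /B powRN invrK.
have key : A `^ (1 - P^-1) * B `^ (1 - m^-1) <= d `^ lam.
  rewrite lamE [X in _ <= X]powRD ?(gt_eqF d0) ?implybT//.
  by apply: ler_pM; rewrite ?powR_ge0// ge0_ler_powR ?nnegrE ?subr_ge0
       ?(ltW A0) ?(ltW B0) ?(ltW d0) ?(ltW iP) ?(ltW im).
rewrite powRN mulrCA ler_pdivrMl ?powR_gt0//.
have -> : a * b = (A `^ (1 - P^-1) * B `^ (1 - m^-1)) * (A^-1 * B^-1).
  rewrite !powRD ?(gt_eqF A0) ?(gt_eqF B0) ?implybT// !powRr1 ?ltW// -aE -bE.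
  by field; rewrite !gt_eqF.
by rewrite ler_wpM2r// mulr_ge0 ?invr_ge0 ?ltW.
Qed.

(* Weighted AM-GM for three functions of (x, y) which, after integration in one
   of the variables, are multiples of a^P or b^m; this needs c < 1 and c' < 0. *)
Lemma product_le_hardy_terms P m lam tau c c' a b X Y : 1 < P -> 1 < m ->
  P^-1 + m^-1 + lam + tau = 2 -> lam + tau < 1 ->
  c * (1 - m^-1) + c' * (1 - P^-1) = tau ->
  0 < a -> 0 < b -> 0 < X -> 0 < Y ->
  a * ((X `^ (- lam) * Y `^ (- tau)) * b) <=
  a `^ P * b `^ m + a `^ P * (X `^ (c - 1) * Y `^ (- c)) +
     b `^ m * (X `^ (c' - 1) * Y `^ (- c')).
Proof.
move=> P1 m1 sE st cE a0 b0 X0 Y0.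
have P0 : 0 < P by lra.
have m0 : 0 < m by lra.
have PN0 : P != 0 by rewrite gt_eqF.
have mN0 : m != 0 by rewrite gt_eqF.
have iP : P^-1 < 1 by rewrite invf_lt1.
have im : m^-1 < 1 by rewrite invf_lt1.
(* The weights t0, t1, t2 are forced by homogeneity in a and b: P (t0 + t1) = 1 and m (t0 + t2) = 1.
   The first is nonnegative because 1/P + 1/m = 2 - (lam + tau) > 1. *)
have t00 : 0 <= P^-1 + m^-1 - 1 by lra.
have t10 : 0 <= 1 - m^-1 by lra.
have t20 : 0 <= 1 - P^-1 by lra.
have tE : P^-1 + m^-1 - 1 + (1 - m^-1) + (1 - P^-1) = 1 by ring.
apply: le_trans (prod_powR_le_sum _ _ _ t00 t10 t20 tE); rewrite ?mulr_gt0 ?powR_gt0//.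
rewrite !powRM ?mulr_ge0 ?powR_ge0// -!powRrM.
have E (z : R) e1 e2 : 0 < z -> z `^ e1 * z `^ e2 = z `^ (e1 + e2).
  by move=> z0; rewrite powRD// (gt_eqF z0) implybT.
rewrite le_eqVlt; apply/orP; left; apply/eqP.
transitivity ((a `^ (P * (P^-1 + m^-1 - 1)) * a `^ (P * (1 - m^-1))) *
  (b `^ (m * (P^-1 + m^-1 - 1)) * b `^ (m * (1 - P^-1))) *
  (X `^ ((c - 1) * (1 - m^-1)) * X `^ ((c' - 1) * (1 - P^-1))) *
  (Y `^ (- c * (1 - m^-1)) * Y `^ (- c' * (1 - P^-1)))); last by ring.
rewrite !E//.
have -> : P * (P^-1 + m^-1 - 1) + P * (1 - m^-1) = 1 by field; rewrite PN0 mN0.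
have -> : m * (P^-1 + m^-1 - 1) + m * (1 - P^-1) = 1 by field; rewrite PN0 mN0.
have -> : (c - 1) * (1 - m^-1) + (c' - 1) * (1 - P^-1) = - lam by lra.
have -> : - c * (1 - m^-1) + - c' * (1 - P^-1) = - tau by lra.
by rewrite !powRr1 ?ltW//; ring.
Qed.

(** If |x - y| <= |y|, or if |x| < |y| < |x - y|, then |x - y| <= 2 |y| and the weight is absorbed
    into the difference kernel. In the remaining region |y| <= |x| <= 2 |x - y|. The factor 2 bounds
    2^e for 0 <= e <= 1. *)
Lemma riesz_kernel_split lam tau x y : 0 < lam -> 0 <= tau -> lam + tau < 1 ->
  x != y -> y != 0 ->
  `|x - y| `^ (- lam) * `|y| `^ (- tau) <=
  2 * (`|x - y| `^ (- (lam + tau)) +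
       (if `|y| <= `|x| then `|x| `^ (- lam) * `|y| `^ (- tau) else 0)).
Proof.
move=> l0 t0 lt xy y0.
set d := `|x - y|; set X := `|x|; set Y := `|y|.
have d0 : 0 < d by rewrite normr_gt0 subr_eq0.
have Y0 : 0 < Y by rewrite normr_gt0.
have dl0 : 0 <= d `^ (- lam) by exact: powR_ge0.
have dlt : d `^ (- (lam + tau)) = d `^ (- lam) * d `^ (- tau).
  by rewrite opprD powRD// (gt_eqF d0) implybT.
have half e : 0 <= e -> e <= 1 -> (2^-1 : R) `^ (- e) <= 2.
  move=> e0 e1; rewrite -[leRHS]powRr1// -powR_inv1// -powRrM mulN1r opprK.
  by rewrite ler_powR ?ler1n.
have T2 : 0 <= if Y <= X then X `^ (- lam) * Y `^ (- tau) else 0.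
  by case: ifP; rewrite // mulr_ge0 ?powR_ge0.
have T1 : 0 <= d `^ (- (lam + tau)) by exact: powR_ge0.
have main e (u w : R) : 0 <= e -> e <= 1 -> 0 < w -> w <= 2 * u ->
    u `^ (- e) <= 2 * w `^ (- e).
  move=> e0 e1 w0 wu; apply: (@le_trans _ _ ((2^-1 * w) `^ (- e))).
    by apply: ge0_ler_powRN; rewrite ?mulr_gt0// ler_pdivrMl.
  by rewrite powRM ?invr_ge0 ?(ltW w0)// ler_wpM2r ?powR_ge0// half.
have [dY|Yd] := leP d Y.
  have : d `^ (- lam) * Y `^ (- tau) <= d `^ (- (lam + tau)).
    by rewrite dlt ler_wpM2l// ge0_ler_powRN.
  lra.
have Xd : X <= 2 * d.
  by have := ler_normD (x - y) y; rewrite subrK -/d -/X -/Y; lra.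
have dXY : d <= X + Y by have := ler_normB x y; rewrite -/d -/X -/Y.
case: ifP T2 => [YX _|/negbT]; last first.
  rewrite -ltNge => XY _; rewrite addr0 dlt mulrCA ler_wpM2l//; apply: main; lra.
have : d `^ (- lam) <= 2 * X `^ (- lam) by apply: main; lra.
move=> /(ler_wpM2r (powR_ge0 Y (- tau))); lra.
Qed.

End RealInequalities.

(** * Bounds for bilinear forms *)

Section BilinearBound.
Local Open Scope ereal_scope.
Context {R : realType} d1 d2 (T1 : measurableType d1) (T2 : measurableType d2).
Variables (mu1 : {sigma_finite_measure set T1 -> \bar R}).
Variables (mu2 : {sigma_finite_measure set T2 -> \bar R}).
Implicit Types (K : T1 * T2 -> \bar R) (f : T1 -> \bar R) (g : T2 -> \bar R).

Definition intop K g (x : T1) := \int[mu2]_y (K (x, y) * g y).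

Lemma nnm_section K x : nnm K -> nnm (fun y => K (x, y)).
Proof. by move=> nK; apply: (nnm_comp (h := pair x)) nK; exact: pair1_measurable. Qed.

Lemma nnm_snd g : nnm g -> nnm (fun z : T1 * T2 => g z.2).
Proof. by apply: (nnm_comp (h := snd)); exact: measurable_snd. Qed.

Lemma nnm_integral_snd K : nnm K -> nnm (fun x => \int[mu2]_y K (x, y)).
Proof.
move=> [mK K0]; split=> [|x]; first exact: measurable_fun_fubini_tonelli_F.
exact: integral_ge0.
Qed.

Lemma nnm_intop K g : nnm K -> nnm g -> nnm (intop K g).
Proof.
move=> nK ng; apply: (@nnm_integral_snd (fun z => K z * g z.2)).
by apply: nnmM => //; exact: nnm_snd.
Qed.

Lemma tonelli K : nnm K ->
  \int[mu1]_x \int[mu2]_y K (x, y) = \int[mu2]_y \int[mu1]_x K (x, y).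
Proof. by move=> [mK K0]; exact: fubini_tonelli. Qed.

Lemma intopZ K g (c : \bar R) x : nnm K -> nnm g -> 0 <= c ->
  intop K (fun y => c * g y) x = c * intop K g x.
Proof.
move=> nK ng c0; rewrite /intop -nnm_integralZl//.
  by apply: eq_integral => y _; rewrite muleCA.
by apply: nnmM => //; exact: nnm_section.
Qed.

Lemma intopD K g g' x : nnm K -> nnm g -> nnm g' ->
  intop K (fun y => g y + g' y) x = intop K g x + intop K g' x.
Proof.
move=> nK ng ng'; rewrite /intop -nnm_integralD; [|by apply: nnmM => //; exact: nnm_section..].
by apply: eq_integral => y _; rewrite ge0_muleDr//; [case: ng|case: ng'].
Qed.

Definition bilinear_bound K (P m C : R) := forall f g, nnm f -> nnm g ->
  \int[mu1]_x (f x * intop K g x) <=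
  C%:E * ((\int[mu1]_x f x `^ P) `^ P^-1 * (\int[mu2]_y g y `^ m) `^ m^-1).

(** [homogeneous_le] is applied to f with the norm of g inside the constant, then to g with f
    already normalized; a null g is treated apart to keep that constant positive. *)
Lemma bilinear_bound_normalized K (P m C : R) : nnm K ->
  (0 < P)%R -> (0 < m)%R -> (0 < C)%R ->
  (forall f g, nnm f -> nnm g -> \int[mu1]_x f x `^ P = 1 ->
    \int[mu2]_y g y `^ m = 1 -> \int[mu1]_x (f x * intop K g x) <= C%:E) ->
  bilinear_bound K P m C.
Proof.
move=> nK P0 m0 C0 H f g nf ng.
have PN0 : P != 0%R by rewrite gt_eqF.
have mN0 : m != 0%R by rewrite gt_eqF.
have g_null g' f' : nnm g' -> \int[mu2]_y g' y `^ m = 0 -> \int[mu1]_x (f' x * intop K g' x) = 0.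
  move=> ng' g'0; apply: integral0_eq => x _; rewrite /intop.
  under eq_integral do rewrite muleC.
  by rewrite (integral_poweR_eq0 mN0 ng' _ g'0) ?mule0//; exact: nnm_section.
have [g0|g0] := eqVneq (\int[mu2]_y g y `^ m) 0.
  by rewrite g_null// mule_ge0 ?lee_fin ?(ltW C0)// mule_ge0// poweR_ge0.
rewrite [X in C%:E * X]muleC muleA.
apply: (homogeneous_le (J := fun f => \int[mu1]_x (f x * intop K g x)) P0) => //.
- by rewrite mule_gt0 ?lte_fin// poweR_gt0// lt0e g0; apply: nnm_integral_ge0; exact: nnm_poweR.
- move=> f' c nf' c0; rewrite -nnm_integralZl ?lee_fin ?(ltW c0)//.
    by apply: eq_integral => x _; rewrite muleA.
  by apply: nnmM => //; exact: nnm_intop.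
- by move=> f' nf' f'0; apply: integral_poweR_eq0 f'0 => //; exact: nnm_intop.
- move=> f' nf' f1.
  apply: (homogeneous_le (J := fun g => \int[mu1]_x (f' x * intop K g x)) m0) => //.
  + move=> g' c ng' c0; rewrite -nnm_integralZl ?lee_fin ?(ltW c0)//.
      by apply: eq_integral => x _; rewrite intopZ ?lee_fin ?(ltW c0)// muleCA.
    by apply: nnmM => //; exact: nnm_intop.
  + by move=> g' ng'; exact: g_null.
  + by move=> g' ng' g1; exact: H.
Qed.

Lemma bilinear_bound_le_add K K1 K2 (P m c C1 C2 : R) :
  nnm K -> nnm K1 -> nnm K2 -> (0 <= c)%R -> (0 <= C1)%R -> (0 <= C2)%R ->
  (forall z, K z <= c%:E * (K1 z + K2 z)) ->
  bilinear_bound K1 P m C1 -> bilinear_bound K2 P m C2 ->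
  bilinear_bound K P m (c * (C1 + C2)).
Proof.
move=> nK nK1 nK2 c0 C10 C20 le B1 B2 f g nf ng; have [_ f0] := nf; have [_ g0] := ng.
have [_ K10] := nK1; have [_ K20] := nK2; have ce0 : 0 <= c%:E by rewrite lee_fin.
set N := _ `^ P^-1 * _ `^ m^-1.
have n1 : nnm (fun x => f x * intop K1 g x) by apply: nnmM => //; exact: nnm_intop.
have n2 : nnm (fun x => f x * intop K2 g x) by apply: nnmM => //; exact: nnm_intop.
apply: (@le_trans _ _ (\int[mu1]_x (c%:E * (f x * intop K1 g x + f x * intop K2 g x)))).
  apply: nnm_le_integral.
  - by apply: nnmM => //; exact: nnm_intop.
  - by apply: nnmM; [exact: nnm_cst|exact: nnmD].
  - move=> x; rewrite -ge0_muleDr; [|by case: (nnm_intop nK1 ng)|by case: (nnm_intop nK2 ng)].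
    rewrite muleCA lee_wpmul2l// /intop -nnm_integralD//;
      [|by apply: nnmM => //; exact: nnm_section..].
    have n12 : nnm (fun y => K1 (x, y) * g y + K2 (x, y) * g y).
      by apply: nnmD; apply: nnmM => //; exact: nnm_section.
    rewrite -nnm_integralZl//; apply: nnm_le_integral.
    + by apply: nnmM => //; exact: nnm_section.
    + by apply: nnmM => //; exact: nnm_cst.
    + by move=> y; rewrite -ge0_muleDl// muleA lee_wpmul2r.
rewrite nnm_integralZl//; last exact: nnmD.
rewrite nnm_integralD// EFinM -muleA lee_wpmul2l// EFinD ge0_muleDl ?lee_fin//.
by apply: leeD; [exact: B1|exact: B2].
Qed.

End BilinearBound.

(** * Integrals of radial functions on the line *)

Section RieszKernelOnR.
Context {R : realType}.
Notation mu := (@lebesgue_measure R).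
Implicit Types (a b e P m lam tau X Y : R).

(** Translation and symmetry reduce to the half-line, which is cut at B: the exponent e1 < 1 is
    integrable at 0 and e2 > 1 at infinity. The power bounds may fail at 0 and B, which are null. *)
Lemma nnm_integral_normr_shift_le (h : R -> R) (B c1 c2 e1 e2 y : R) :
  measurable_fun setT h -> (forall t, 0 <= h t) -> 0 < B -> 0 <= c1 -> 0 <= c2 ->
  e1 < 1 -> 1 < e2 ->
  (forall t, 0 < t -> t < B -> h t <= c1 * t `^ (- e1)) ->
  (forall t, B < t -> h t <= c2 * t `^ (- e2)) ->
  (\int[mu]_x (h `|x - y|)%:E <=
   (2 * (c1 * (B `^ (1 - e1) / (1 - e1)) + c2 * (B `^ (1 - e2) / (e2 - 1))))%:E)%E.
Proof.
move=> mh h0 B0 c10 c20 e11 e21 h1 h2.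
have nh := nnm_EFin mh h0; have [meh eh0] := nh.
have mc (c e : R) : measurable_fun setT (fun x : R => c%:E * (x `^ (- e))%:E)%E.
  by apply: emeasurable_funM => //; case: (nnm_powR (R:=R) (- e)).
rewrite (integral_shift y (nnm_comp (@normr_measurable _ setT) nh)) (integral_normr nh).
rewrite EFinM lee_pmul2l ?lte_fin// -integral_itv_obnd_cbnd; last exact: measurable_funTS.
have -> : `]0%R, +oo[%classic = `]0%R, B]%classic `|` `]B, +oo[%classic :> set R.
  apply/seteqP; split=> x /=; rewrite !in_itv/= !andbT.
    by move=> x0; case: (leP x B) => xB; [left; rewrite x0|right].
  by move=> [/andP[]//|]; exact: lt_trans.
rewrite ge0_integral_setU//=; [|exact: measurable_funTS|]; last first.
  apply/disj_setPS => x /= []; rewrite !in_itv/= andbT => /andP[_ xB] Bx.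
  by move: (le_lt_trans xB Bx); rewrite ltxx.
rewrite EFinD; apply: leeD.
- rewrite EFinM; apply: (@le_trans _ _ (c1%:E * \int[mu]_(x in `]0%R, B]) (x `^ (- e1))%:E)%E).
    rewrite -ge0_integralZl//; last 2 first.
    + by apply: measurable_funTS; case: (nnm_powR (R:=R) (- e1)).
    + by move=> x _; rewrite lee_fin powR_ge0.
    rewrite -integral_itv_bndo_bndc; last exact: measurable_funTS.
    rewrite -[leRHS]integral_itv_bndo_bndc; last by apply: measurable_funTS; exact: mc.
    apply: ge0_le_integral => //.
    + exact: measurable_funTS.
    + by apply: measurable_funTS; exact: mc.
    + by move=> x; rewrite /= in_itv/= => /andP[x0 xB]; rewrite -EFinM lee_fin h1.
  by rewrite lee_wpmul2l ?lee_fin// integral_powR_near0_le.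
- rewrite EFinM integral_itv_obnd_cbnd; last exact: measurable_funTS.
  apply: (@le_trans _ _ (c2%:E * \int[mu]_(x in `[B, +oo[) (x `^ (- e2))%:E)%E).
    rewrite -ge0_integralZl//; last 2 first.
    + by apply: measurable_funTS; case: (nnm_powR (R:=R) (- e2)).
    + by move=> x _; rewrite lee_fin powR_ge0.
    rewrite -integral_itv_obnd_cbnd; last exact: measurable_funTS.
    rewrite -[leRHS]integral_itv_obnd_cbnd; last exact: measurable_funTS.
    apply: ge0_le_integral => //.
    + exact: measurable_funTS.
    + by apply: measurable_funTS; exact: mc.
    + by move=> x; rewrite /= in_itv/= andbT => xB; rewrite -EFinM lee_fin h2.
  by rewrite lee_wpmul2l ?lee_fin// integral_powR_infty_le.
Qed.

End RieszKernelOnR.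

(** * The weighted Hardy-Littlewood-Sobolev inequality on the line *)

Section HardyLittlewoodSobolevOnR.
Context {R : realType}.
Notation RT := (measurableTypeR R).
Notation mu := (@lebesgue_measure R).
Implicit Types (a b e P m lam tau X Y : R).

Lemma level_term_ge0 m e lam b d : 0 <= b -> 0 <= level_term m e lam b d.
Proof. by move=> b0; rewrite /level_term !mulr_ge0 ?powR_ge0. Qed.

Lemma measurable_level_term m e lam d (T : measurableType d) (h k : T -> R) :
  measurable_fun setT h -> measurable_fun setT k ->
  measurable_fun setT (fun x => level_term m e lam (h x) (k x)).
Proof.
move=> mh mk; apply: measurable_funM => //; apply: measurable_funM.
  by apply: measurable_powR_comp; apply: measurable_maxr => //; exact: measurable_powR_comp.
exact: measurable_powR_comp.
Qed.

Lemma integral_level_term_le m e lam b y : 1 < m -> lam < 1 -> 0 <= e ->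
  e + lam + m^-1 = 2 -> 0 <= b ->
  (\int[mu]_x (level_term m e lam b `|x - y|)%:E <=
   (2 * ((1 - lam)^-1 + (1 - m^-1)^-1) * b `^ m)%:E)%E.
Proof.
move=> m1 lam1 e0 elm; rewrite le_eqVlt => /predU1P[<-|b0].
  rewrite integral0_eq ?lee_fin; last by move=> x _; rewrite /level_term mul0r.
  by rewrite mulr_ge0 ?powR_ge0// mulr_ge0// addr_ge0// invr_ge0 subr_ge0 ?(ltW lam1)//
    invf_le1 ?(ltW m1)// (lt_trans ltr01).
have im : m^-1 < 1 by rewrite invf_lt1// (lt_trans ltr01).
have elam : 1 < e + lam by lra.
(* The maximum in [level_term] switches at B, leaving the exponent lam < 1 below it and e + lam = 2
   - 1/m > 1 above it. *)
pose B := b `^ (- m).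
have B0 : 0 < B by exact: powR_gt0.
apply: (le_trans (nnm_integral_normr_shift_le (h := level_term m e lam b) (B := B)
  (c1 := b * B `^ (- e)) (c2 := b) (e1 := lam) (e2 := e + lam) _ _ _ _ _ _ _ _ _ _)) => //.
- exact: measurable_level_term.
- by move=> t; apply: level_term_ge0; exact: ltW.
- by rewrite mulr_ge0 ?powR_ge0// ltW.
- exact: ltW.
- by move=> t t0 tB; rewrite /level_term -/B max_l ?(ltW tB)// mulrA.
- move=> t Bt; have t0 := lt_trans B0 Bt.
  by rewrite /level_term -/B max_r ?(ltW Bt)// -powRD ?opprD// (gt_eqF t0) implybT.
- rewrite lee_fin le_eqVlt; apply/orP; left; apply/eqP.
  have E : b * B `^ (1 - (e + lam)) = b `^ m.
    rewrite /B -powRrM -[X in X * _]powRr1 ?(ltW b0)// -powRD ?(gt_eqF b0) ?implybT//.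
    congr (_ `^ _); have -> : e + lam = 2 - m^-1 by lra.
    by field; rewrite gt_eqF// (lt_trans ltr01).
  have E2 : b * B `^ (- e) * B `^ (1 - lam) = b `^ m.
    rewrite -E -mulrA -powRD ?(gt_eqF B0) ?implybT//; congr (_ * _ `^ _); ring.
  have E3 : e + lam - 1 = 1 - m^-1 by lra.
  rewrite !mulrA E E2 E3; ring.
Qed.

Lemma nnm_normr_kernel lam : nnm (fun z : RT * RT => (`|(z.1 : R) - (z.2 : R)| `^ (- lam))%:E).
Proof.
apply: nnm_EFin => [|z]; last exact: powR_ge0.
apply: measurable_powR_comp; apply: measurableT_comp => //.
by apply: measurable_funB; [exact: measurable_fst|exact: measurable_snd].
Qed.

(** For unit norms the three terms of [product_le_level_terms] contribute C1, C2 and 1: the first is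
    integrated in y and leaves C1 f^P, the second in x and leaves C2 g^m, the third is a product of
    two unit integrals. *)
Lemma hardy_littlewood_sobolev P m lam : 1 < P -> 1 < m ->
  P^-1 + m^-1 + lam = 2 -> 0 < lam -> lam < 1 ->
  exists2 C : R, 0 <= C & bilinear_bound mu mu
    (fun z : RT * RT => (`|(z.1 : R) - (z.2 : R)| `^ (- lam))%:E) P m C.
Proof.
move=> P1 m1 Pml lam0 lam1.
have P0 : 0 < P by lra.
have m0 : 0 < m by lra.
have PN0 : P != 0 by rewrite gt_eqF.
have mN0 : m != 0 by rewrite gt_eqF.
have iP : P^-1 < 1 by rewrite invf_lt1.
have im : m^-1 < 1 by rewrite invf_lt1.
have iP0 : 0 <= P^-1 by rewrite invr_ge0 ltW.
have im0 : 0 <= m^-1 by rewrite invr_ge0 ltW.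
have E1 : m^-1 + lam + P^-1 = 2 by lra.
have E2 : P^-1 + lam + m^-1 = 2 by lra.
pose C1 := 2 * ((1 - lam)^-1 + (1 - P^-1)^-1).
pose C2 := 2 * ((1 - lam)^-1 + (1 - m^-1)^-1).
have C10 : 0 < C1 by rewrite mulr_gt0// addr_gt0// invr_gt0; lra.
have C20 : 0 < C2 by rewrite mulr_gt0// addr_gt0// invr_gt0; lra.
have C0 : 0 < C1 + C2 + 1 by lra.
exists (C1 + C2 + 1); first exact: ltW.
have nK := nnm_normr_kernel lam.
apply: bilinear_bound_normalized => // f g nf ng f1 g1.
have [mf f0] := nf; have [mg g0] := ng.
have ff0 x : 0 <= fine (f x) by exact: fine_ge0.
have fg0 x : 0 <= fine (g x) by exact: fine_ge0.
have mff : measurable_fun setT (fun x => fine (f x)) by exact: measurableT_comp.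
have mfg : measurable_fun setT (fun x => fine (g x)) by exact: measurableT_comp.
have m12 : measurable_fun setT (fun z : RT * RT => `|(z.1 : R) - (z.2 : R)|).
  apply: measurableT_comp => //.
  by apply: measurable_funB; [exact: measurable_fst|exact: measurable_snd].
(* [fine] sends +oo to 0, which does no harm: where one of f and g is infinite and the other
   positive, T3 is already infinite. *)
pose T1 (z : RT * RT) := (level_term P m^-1 lam (fine (f z.1)) `|(z.1 : R) - (z.2 : R)|)%:E.
pose T2 (z : RT * RT) := (level_term m P^-1 lam (fine (g z.2)) `|(z.1 : R) - (z.2 : R)|)%:E.
pose T3 (z : RT * RT) := (f z.1 `^ P * g z.2 `^ m)%E.
have nT1 : nnm T1.
  apply: nnm_EFin => [|z]; last by apply: level_term_ge0; apply: fine_ge0.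
  by apply: measurable_level_term => //; exact: (measurableT_comp mff measurable_fst).
have nT2 : nnm T2.
  apply: nnm_EFin => [|z]; last by apply: level_term_ge0; apply: fine_ge0.
  by apply: measurable_level_term => //; exact: (measurableT_comp mfg measurable_snd).
have nfP := nnm_poweR P nf; have ngm := nnm_poweR m ng.
have nT3 : nnm T3 by apply: nnmM; [exact: (nnm_comp measurable_fst nfP)|exact: (nnm_comp measurable_snd ngm)].
have fine_pow (h : \bar R) e : (0 < e)%R -> (0 <= h)%E -> ((fine h `^ e)%:E <= h `^ e)%E.
  by case: h => [r| |]//= e0; rewrite ?leey// gt_eqF// leey.
have IT1 : (\int[mu]_x \int[mu]_y T1 (x, y) <= C1%:E)%E.
  apply: (@le_trans _ _ (\int[mu]_x (C1%:E * f x `^ P))%E).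
    apply: nnm_le_integral; first exact: (nnm_integral_snd _ nT1).
      by apply: nnmM => //; apply: nnm_cst; rewrite lee_fin ltW.
    move=> x; apply: (@le_trans _ _ ((C1 * fine (f x) `^ P)%:E)).
      under eq_integral do rewrite /T1/= distrC.
      exact: (integral_level_term_le _ P1 lam1 im0 E1).
    by rewrite EFinM lee_wpmul2l ?lee_fin ?(ltW C10)// fine_pow.
  by rewrite nnm_integralZl ?lee_fin ?(ltW C10)// f1 mule1.
have IT2 : (\int[mu]_x \int[mu]_y T2 (x, y) <= C2%:E)%E.
  rewrite tonelli//.
  apply: (@le_trans _ _ (\int[mu]_y (C2%:E * g y `^ m))%E).
    apply: nnm_le_integral.
    - split=> [|y]; last by apply: integral_ge0 => x _; case: nT2.
      by apply: measurable_fun_fubini_tonelli_G; case: nT2.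
    - by apply: nnmM => //; apply: nnm_cst; rewrite lee_fin ltW.
    - move=> y; apply: (@le_trans _ _ ((C2 * fine (g y) `^ m)%:E)).
        rewrite /T2/=; exact: (integral_level_term_le _ m1 lam1 iP0 E2).
      by rewrite EFinM lee_wpmul2l ?lee_fin ?(ltW C20)// fine_pow.
  by rewrite nnm_integralZl ?lee_fin ?(ltW C20)// g1 mule1.
have IT3 : (\int[mu]_x \int[mu]_y T3 (x, y) = 1)%E.
  rewrite -[RHS]f1; apply: eq_integral => x _.
  by rewrite /T3/= (nnm_integralZl mu ngm (poweR_ge0 _ _)) g1 mule1.
have nT12 := nnmD nT1 nT2; have nT := nnmD nT12 nT3.
apply: (@le_trans _ _ (\int[mu]_x \int[mu]_y (T1 (x, y) + T2 (x, y) + T3 (x, y)))%E).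
  apply: nnm_le_integral.
  - by apply: nnmM => //; exact: nnm_intop.
  - exact: (nnm_integral_snd _ nT).
  - move=> x; rewrite -nnm_integralZl//; last first.
      by apply: nnmM => //; exact: (nnm_section x nK).
    apply: nnm_le_integral.
    + by do 2 (apply: nnmM; first by [exact: nnm_cst|exact: (nnm_section x nK)]).
    + exact: (nnm_section x nT).
    + move=> y; rewrite /T1 /T2 /T3/=.
      have S0 : (0 <= (level_term P m^-1 lam (fine (f x)) `|x - y|)%:E +
          (level_term m P^-1 lam (fine (g y)) `|x - y|)%:E)%E.
        by rewrite adde_ge0// lee_fin level_term_ge0.
      have R0 : (0 <= f x `^ P * g y `^ m)%E by rewrite mule_ge0// poweR_ge0.
      (* On the diagonal the kernel is 0, because [powR] sends 0 to 0 for a nonzero exponent. *)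
      have [xy|xy] := eqVneq x y.
        have k0 : `|x - y| `^ (- lam) = 0.
          by rewrite xy subrr normr0 powR0// oppr_eq0 (gt_eqF lam0).
        by apply: le_trans (adde_ge0 S0 R0); rewrite k0 mul0e mule0.
      have d0 : 0 < `|x - y| by rewrite normr_gt0 subr_eq0.
      have [fx0|fx0] := eqVneq (f x) 0%E; first by apply: le_trans (adde_ge0 S0 R0); rewrite fx0 mul0e.
      have [gy0|gy0] := eqVneq (g y) 0%E; first by apply: le_trans (adde_ge0 S0 R0); rewrite gy0 !mule0.
      have fxgt : (0 < f x)%E by rewrite lt0e fx0 f0.
      have gygt : (0 < g y)%E by rewrite lt0e gy0 g0.
      have [fxy|fxy] := eqVneq (f x) +oo%E.
        rewrite [X in (_ <= _ + X)%E](_ : _ = +oo%E) ?addey ?leey//.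
        by rewrite fxy poweRyr// gt0_mulye// poweR_gt0.
      have [gyy|gyy] := eqVneq (g y) +oo%E.
        rewrite [X in (_ <= _ + X)%E](_ : _ = +oo%E) ?addey ?leey//.
        by rewrite gyy poweRyr// gt0_muley// poweR_gt0.
      move: fxgt gygt fxy gyy; case: (f x) => [a| |]//; case: (g y) => [b| |]//.
      rewrite !lte_fin => a0 b0 _ _; rewrite !poweR_EFin -!EFinM -!EFinD lee_fin /=.
      exact: product_le_level_terms.
rewrite (eq_integral (fun x => (\int[mu]_y (T1 (x, y) + T2 (x, y)) + \int[mu]_y T3 (x, y))%E));
  last by move=> x _; rewrite nnm_integralD//; [exact: (nnm_section x nT12)|exact: (nnm_section x nT3)].
rewrite nnm_integralD; [|exact: (nnm_integral_snd _ nT12)|exact: (nnm_integral_snd _ nT3)].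
rewrite (eq_integral (fun x => (\int[mu]_y T1 (x, y) + \int[mu]_y T2 (x, y))%E));
  last by move=> x _; rewrite nnm_integralD//; [exact: (nnm_section x nT1)|exact: (nnm_section x nT2)].
rewrite nnm_integralD; [|exact: (nnm_integral_snd _ nT1)|exact: (nnm_integral_snd _ nT2)].
by rewrite IT3 !EFinD leeD// leeD.
Qed.

End HardyLittlewoodSobolevOnR.

(** * The Hardy part of the weighted kernel *)

Section WeightedHLS.
Context {R : realType}.
Notation RT := (measurableTypeR R).
Notation mu := (@lebesgue_measure R).
Implicit Types (a b e P m lam tau X Y : R).

(* The value 0 at z.2 = 0 matters for b = 0, since 0 `^ 0 = 1. *)
Definition cone_fun (a b : R) (z : RT * RT) : R :=
  if (0 < `|z.2 : R|) && (`|z.2 : R| <= `|z.1 : R|) then `|z.1 : R| `^ a * `|z.2 : R| `^ b else 0.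

Lemma measurable_normr_fst : measurable_fun setT (fun z : RT * RT => `|z.1 : R|).
Proof. by apply: measurableT_comp => //; exact: measurable_fst. Qed.

Lemma measurable_normr_snd : measurable_fun setT (fun z : RT * RT => `|z.2 : R|).
Proof. by apply: measurableT_comp => //; exact: measurable_snd. Qed.

Lemma cone_fun_ge0 a b z : 0 <= cone_fun a b z.
Proof. by rewrite /cone_fun; case: ifP => // _; rewrite mulr_ge0 ?powR_ge0. Qed.

Lemma nnm_cone_fun a b : nnm (fun z => (cone_fun a b z)%:E).
Proof.
apply: nnm_EFin => [|z]; last exact: cone_fun_ge0.
apply: measurable_fun_ifT => //.
  apply: measurable_and.
    by apply: measurable_fun_ltr => //; exact: measurable_normr_snd.
  by apply: measurable_fun_ler; [exact: measurable_normr_snd|exact: measurable_normr_fst].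
by apply: measurable_funM; apply: measurable_powR_comp;
  [exact: measurable_normr_fst|exact: measurable_normr_snd].
Qed.

(** The exponents c - 1 and - c add up to -1, so by homogeneity the integral over |y| <= |x| has a
    bound independent of x; c < 1 gives convergence at y = 0. *)
Lemma integral_cone_fun_snd_le c (x : RT) : c < 1 -> c != 0 ->
  (\int[mu]_y (cone_fun (c - 1) (- c) (x, y))%:E <= (2 / (1 - c))%:E)%E.
Proof.
move=> c1 cN0; have c10 : 0 < 1 - c by rewrite subr_gt0.
have [x0|x0] := eqVneq (x : R) 0.
  rewrite integral0_eq ?lee_fin ?divr_ge0 ?(ltW c10)// => y _; rewrite /cone_fun/= x0 normr0.
  by case: ifP => // _; rewrite powR0 ?mul0r// subr_eq0 lt_eqF.
have X0 : 0 < `|x : R| by rewrite normr_gt0.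
pose h t : R := if (0 < t) && (t <= `|x : R|) then `|x : R| `^ (c - 1) * t `^ (- c) else 0.
have mh : measurable_fun setT h.
  apply: measurable_fun_ifT => //.
    by apply: measurable_and; [exact: measurable_fun_ltr|exact: measurable_fun_ler].
  by apply: measurable_funM => //; exact: measurable_powR.
have h0 t : 0 <= h t by rewrite /h; case: ifP => // _; rewrite mulr_ge0 ?powR_ge0.
apply: (@le_trans _ _ (\int[mu]_y (h `|y - 0|)%:E)%E).
  by under [leRHS]eq_integral do rewrite subr0.
have h1 t : 0 < t -> t < `|x : R| -> h t <= `|x : R| `^ (c - 1) * t `^ (- c).
  by move=> t0 tx; rewrite /h t0 (ltW tx).
(* Beyond |x| the function h vanishes, so the constant 0 works with any exponent above 1, here 2. *)
have h2 t : `|x : R| < t -> h t <= 0 * t `^ (- 2).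
  by move=> xt; rewrite /h [t <= _]leNgt xt andbF mul0r.
apply: (le_trans (nnm_integral_normr_shift_le 0 mh h0 X0 (powR_ge0 _ _) (lexx 0) c1
  (ltr1n R 2) h1 h2)).
rewrite lee_fin mul0r addr0 le_eqVlt; apply/orP; left; apply/eqP.
  have : `|x : R| `^ (c - 1) * `|x : R| `^ (1 - c) = 1.
    by rewrite -powRD ?(gt_eqF X0) ?implybT// addrA subrK subrr powRr0.
  by move=> E; rewrite [X in 2 * X]mulrA E mul1r.
Qed.

(** The same homogeneity on |x| >= |y|, where c < 0 gives convergence at infinity. *)
Lemma integral_cone_fun_fst_le c (y : RT) : c < 0 ->
  (\int[mu]_x (cone_fun (c - 1) (- c) (x, y))%:E <= (2 / - c)%:E)%E.
Proof.
move=> c0; have c10 : 0 < - c by rewrite oppr_gt0.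
have [y0|y0] := eqVneq (y : R) 0.
  rewrite integral0_eq ?lee_fin ?divr_ge0 ?(ltW c10)// => x _; rewrite /cone_fun/= y0 normr0.
  by rewrite ltxx.
have Y0 : 0 < `|y : R| by rewrite normr_gt0.
pose h t : R := if `|y : R| <= t then t `^ (c - 1) * `|y : R| `^ (- c) else 0.
have mh : measurable_fun setT h.
  apply: measurable_fun_ifT => //; first exact: measurable_fun_ler.
  by apply: measurable_funM => //; exact: measurable_powR.
have h0 t : 0 <= h t by rewrite /h; case: ifP => // _; rewrite mulr_ge0 ?powR_ge0.
apply: (@le_trans _ _ (\int[mu]_x (h `|x - 0|)%:E)%E).
  rewrite le_eqVlt; apply/orP; left; apply/eqP; apply: eq_integral => x _.
  by rewrite subr0 /cone_fun/= Y0.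
have h1 t : 0 < t -> t < `|y : R| -> h t <= 0 * t `^ (- 0).
  by move=> _ tx; rewrite /h [_ <= t]leNgt tx mul0r.
have h2 t : `|y : R| < t -> h t <= `|y : R| `^ (- c) * t `^ (- (1 - c)).
  by move=> yt; rewrite /h (ltW yt) mulrC opprB.
have c1 : 1 < 1 - c by rewrite ltrDl.
apply: (le_trans (nnm_integral_normr_shift_le 0 mh h0 Y0 (lexx 0) (powR_ge0 _ _) ltr01 c1 h1 h2)).
rewrite lee_fin mul0r add0r le_eqVlt; apply/orP; left; apply/eqP.
have : `|y : R| `^ (- c) * `|y : R| `^ (1 - (1 - c)) = 1.
  rewrite -powRD ?(gt_eqF Y0) ?implybT//.
  by rewrite (_ : - c + (1 - (1 - c)) = 0) ?powRr0//; ring.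
by move=> E; rewrite [X in 2 * X]mulrA E mul1r [1 - c]addrC addrK.
Qed.

(** The condition tau + 1/m < 1 says that |y|^(-tau) is locally in the dual of L^m. It is what
    leaves room for exponents c < 1 and c' < 0 in [product_le_hardy_terms], making its last two
    terms integrable in y and in x. *)
Lemma hardy_bilinear_bound P m lam tau : 1 < P -> 1 < m ->
  P^-1 + m^-1 + lam + tau = 2 -> 0 < lam -> 0 <= tau -> lam + tau < 1 -> tau + m^-1 < 1 ->
  exists2 C : R, 0 <= C & bilinear_bound mu mu (fun z => (cone_fun (- lam) (- tau) z)%:E) P m C.
Proof.
move=> P1 m1 Pml lam0 tau0 lt1 tm.
have P0 : 0 < P by lra.
have m0 : 0 < m by lra.
have iP : P^-1 < 1 by rewrite invf_lt1.
have im : m^-1 < 1 by rewrite invf_lt1.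
pose t1 := 1 - m^-1; pose t2 := 1 - P^-1.
have t10 : 0 < t1 by rewrite subr_gt0.
have t20 : 0 < t2 by rewrite subr_gt0.
have t1N0 : t1 != 0 by rewrite gt_eqF.
have t2N0 : t2 != 0 by rewrite gt_eqF.
have tt1 : tau < t1 by rewrite /t1; lra.
(* Since tau < t1, the value of c t1 is taken to be the midpoint of tau and t1, so c < 1; the
   negative remainder (tau - t1)/2 is c' t2. *)
pose c := (1 + tau / t1) / 2; pose c' := (tau - t1) / 2 / t2.
have cE : c * (1 - m^-1) + c' * (1 - P^-1) = tau.
  by rewrite -/t1 -/t2 /c /c'; field; rewrite t2N0 t1N0.
have ct0 : 0 <= tau / t1 by rewrite divr_ge0 ?(ltW t10).
have ct1 : tau / t1 < 1 by rewrite ltr_pdivrMr// mul1r.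
have c1 : c < 1 by rewrite /c; lra.
have c0 : 0 < c by rewrite /c; lra.
have c'0 : c' < 0 by rewrite /c' pmulr_llt0 ?invr_gt0//; lra.
pose C1 := 2 / (1 - c); pose C2 := 2 / - c'.
have C10 : 0 < C1 by rewrite divr_gt0 ?subr_gt0.
have C20 : 0 < C2 by rewrite divr_gt0 ?oppr_gt0.
have C0 : 0 < 1 + C1 + C2 by lra.
exists (1 + C1 + C2); first exact: ltW.
have nK := nnm_cone_fun (- lam) (- tau).
have nK1 := nnm_cone_fun (c - 1) (- c).
have nK2 := nnm_cone_fun (c' - 1) (- c').
apply: bilinear_bound_normalized => // f g nf ng f1 g1.
have [mf f0] := nf; have [mg g0] := ng.
have nfP := nnm_poweR P nf; have ngm := nnm_poweR m ng.
pose T1 (z : RT * RT) := (f z.1 `^ P * g z.2 `^ m)%E.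
pose T2 (z : RT * RT) := (f z.1 `^ P * (cone_fun (c - 1) (- c) z)%:E)%E.
pose T3 (z : RT * RT) := (g z.2 `^ m * (cone_fun (c' - 1) (- c') z)%:E)%E.
have nT1 : nnm T1.
  by apply: nnmM; [exact: (nnm_comp measurable_fst nfP)|exact: (nnm_comp measurable_snd ngm)].
have nT2 : nnm T2 by apply: nnmM => //; exact: (nnm_comp measurable_fst nfP).
have nT3 : nnm T3 by apply: nnmM => //; exact: (nnm_comp measurable_snd ngm).
have IT1 : (\int[mu]_x \int[mu]_y T1 (x, y) = 1)%E.
  rewrite -[RHS]f1; apply: eq_integral => x _.
  by rewrite /T1/= (nnm_integralZl mu ngm (poweR_ge0 _ _)) g1 mule1.
have IT2 : (\int[mu]_x \int[mu]_y T2 (x, y) <= C1%:E)%E.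
  apply: (@le_trans _ _ (\int[mu]_x (f x `^ P * C1%:E))%E).
    apply: nnm_le_integral; first exact: (nnm_integral_snd _ nT2).
      by apply: nnmM => //; apply: nnm_cst; rewrite lee_fin ltW.
    move=> x; rewrite /T2/= (nnm_integralZl mu (nnm_section x nK1) (poweR_ge0 _ _)).
    by rewrite lee_wpmul2l ?poweR_ge0//; apply: integral_cone_fun_snd_le; rewrite ?gt_eqF.
  by rewrite nnm_integralZr ?lee_fin ?(ltW C10)// f1 mul1e.
have IT3 : (\int[mu]_x \int[mu]_y T3 (x, y) <= C2%:E)%E.
  rewrite tonelli//.
  apply: (@le_trans _ _ (\int[mu]_y (g y `^ m * C2%:E))%E).
    apply: nnm_le_integral.
    - split=> [|y]; last by apply: integral_ge0 => x _; case: nT3.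
      by apply: measurable_fun_fubini_tonelli_G; case: nT3.
    - by apply: nnmM => //; apply: nnm_cst; rewrite lee_fin ltW.
    - move=> y; have nK2y : nnm (fun x => (cone_fun (c' - 1) (- c') (x, y))%:E).
        by apply: (nnm_comp (h := fun x => (x, y))) nK2; exact: pair2_measurable.
      rewrite /T3/= (nnm_integralZl mu nK2y (poweR_ge0 _ _)).
      by rewrite lee_wpmul2l ?poweR_ge0//; exact: integral_cone_fun_fst_le.
  by rewrite nnm_integralZr ?lee_fin ?(ltW C20)// g1 mul1e.
have nT12 := nnmD nT1 nT2; have nT := nnmD nT12 nT3.
apply: (@le_trans _ _ (\int[mu]_x \int[mu]_y (T1 (x, y) + T2 (x, y) + T3 (x, y)))%E).
  apply: nnm_le_integral.
  - by apply: nnmM => //; exact: nnm_intop.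
  - exact: (nnm_integral_snd _ nT).
  - move=> x; rewrite -nnm_integralZl//; last first.
      by apply: nnmM => //; exact: (nnm_section x nK).
    apply: nnm_le_integral.
    + by do 2 (apply: nnmM; first by [exact: nnm_cst|exact: (nnm_section x nK)]).
    + exact: (nnm_section x nT).
    + move=> y; rewrite /T1 /T2 /T3/=.
      have S0 : (0 <= f x `^ P * g y `^ m +
          f x `^ P * (cone_fun (c - 1) (- c) (x, y))%:E +
          g y `^ m * (cone_fun (c' - 1) (- c') (x, y))%:E)%E.
        by case: nT => _ /(_ (x, y)).
      have [fx0|fx0] := eqVneq (f x) 0%E; first by apply: le_trans S0; rewrite fx0 mul0e.
      have [gy0|gy0] := eqVneq (g y) 0%E; first by apply: le_trans S0; rewrite gy0 !mule0.
      have fxgt : (0 < f x)%E by rewrite lt0e fx0 f0.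
      have gygt : (0 < g y)%E by rewrite lt0e gy0 g0.
      have [fgy|fgy] := eqVneq (f x `^ P * g y `^ m)%E +oo%E.
        by rewrite fgy !addye ?leey// -ltNye (lt_le_trans ltNy0)//
           mule_ge0 ?poweR_ge0 ?lee_fin ?cone_fun_ge0.
      have fxy : f x != +oo%E.
        by apply: contra_neq fgy => ->; rewrite poweRyr ?gt_eqF// gt0_mulye// poweR_gt0.
      have gyy : g y != +oo%E.
        by apply: contra_neq fgy => ->; rewrite poweRyr ?gt_eqF// gt0_muley// poweR_gt0.
      have [xN0|xN0] := eqVneq (x : R) 0.
        by apply: le_trans S0; rewrite /cone_fun/= xN0 normr0; case: ifP => _;
          rewrite ?powR0 ?oppr_eq0 ?gt_eqF// ?mul0r ?mul0e ?mule0.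
      have X0 : 0 < `|x : R| by rewrite normr_gt0.
      move: S0; rewrite /cone_fun/=; case: ifP => [/andP[Y0 _]|_]; last first.
        by rewrite mul0e !mule0.
      move: fxgt gygt fxy gyy {fx0 gy0 fgy}; case: (f x) => [a| |]//; case: (g y) => [b| |]//.
      rewrite !lte_fin => a0 b0 _ _ S0; rewrite !poweR_EFin -!EFinM -!EFinD lee_fin.
      exact: product_le_hardy_terms.
rewrite (eq_integral (fun x => (\int[mu]_y (T1 (x, y) + T2 (x, y)) + \int[mu]_y T3 (x, y))%E));
  last by move=> x _; rewrite nnm_integralD//; [exact: (nnm_section x nT12)|exact: (nnm_section x nT3)].
rewrite nnm_integralD; [|exact: (nnm_integral_snd _ nT12)|exact: (nnm_integral_snd _ nT3)].
rewrite (eq_integral (fun x => (\int[mu]_y T1 (x, y) + \int[mu]_y T2 (x, y))%E));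
  last by move=> x _; rewrite nnm_integralD//; [exact: (nnm_section x nT1)|exact: (nnm_section x nT2)].
rewrite nnm_integralD; [|exact: (nnm_integral_snd _ nT1)|exact: (nnm_integral_snd _ nT2)].
by rewrite IT1 !EFinD leeD// leeD.
Qed.

End WeightedHLS.

(** * The weighted Riesz kernel on the line *)

Section RieszR.
Context {R : realType}.
Notation RT := (measurableTypeR R).
Notation mu := (@lebesgue_measure R).

Definition riesz1 (lam tau : R) (z : RT * RT) : R :=
  `|(z.1 : R) - (z.2 : R)| `^ (- lam) * `|z.2 : R| `^ (- tau).

Lemma nnm_riesz1 (lam tau : R) : nnm (fun z => (riesz1 lam tau z)%:E).
Proof.
apply: nnm_EFin => [|z]; last by rewrite mulr_ge0 ?powR_ge0.
apply: measurable_funM; apply: measurable_powR_comp; last exact: measurable_normr_snd.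
by apply: measurableT_comp => //; apply: measurable_funB; [exact: measurable_fst|exact: measurable_snd].
Qed.

Lemma riesz1_bilinear_bound (P m lam tau : R) : 1 < P -> 1 < m ->
  P^-1 + m^-1 + lam + tau = 2 -> 0 < lam -> 0 <= tau -> lam + tau < 1 -> tau + m^-1 < 1 ->
  exists2 C : R, 0 <= C & bilinear_bound mu mu (fun z => (riesz1 lam tau z)%:E) P m C.
Proof.
move=> P1 m1 Pml lam0 tau0 lt1 tm.
have lt0 : 0 < lam + tau by lra.
have sE : P^-1 + m^-1 + (lam + tau) = 2 by lra.
have [C1 C10 B1] := hardy_littlewood_sobolev P1 m1 sE lt0 lt1.
have [C2 C20 B2] := hardy_bilinear_bound P1 m1 Pml lam0 tau0 lt1 tm.
exists (2 * (C1 + C2)); first by rewrite mulr_ge0// addr_ge0.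
apply: bilinear_bound_le_add B1 B2 => //.
- exact: nnm_riesz1.
- exact: nnm_normr_kernel.
- exact: nnm_cone_fun.
move=> [x y]; rewrite -EFinD -EFinM lee_fin /riesz1 /=.
have RHS0 : 0 <= 2 * (`|(x : R) - (y : R)| `^ (- (lam + tau)) + cone_fun (- lam) (- tau) (x, y)).
  by rewrite mulr_ge0// addr_ge0 ?powR_ge0// cone_fun_ge0.
have [xy|xy] := eqVneq (x : R) (y : R).
  by apply: le_trans RHS0; rewrite xy subrr normr0 powR0 ?mul0r// oppr_eq0 gt_eqF.
have [y0|y0] := eqVneq (y : R) 0; last first.
  by have := riesz_kernel_split lam0 tau0 lt1 xy y0; rewrite /cone_fun/= normr_gt0 y0.
(* At y = 0 the weight 0^(-tau) is 0 if tau is nonzero, but 1 if tau = 0; in the latter case the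
   difference kernel alone bounds the left-hand side. *)
have [t0|t0] := eqVneq tau 0; last first.
  by apply: le_trans RHS0; rewrite y0 normr0 [0 `^ _]powR0 ?mulr0// oppr_eq0.
rewrite t0 oppr0 powRr0 mulr1 addr0.
have A0 : 0 <= `|(x : R) - (y : R)| `^ (- lam) by exact: powR_ge0.
have := cone_fun_ge0 (- lam) 0 (x, y); lra.
Qed.

End RieszR.

(** * Lebesgue measure on tuples *)

Section TupleMeasure.
Context {R : realType}.
Notation RT := (measurableTypeR R).
Notation mu := (@lebesgue_measure R).
Local Open Scope ereal_scope.

Definition tcons n (z : RT * n.-tuple RT) : n.+1.-tuple RT := [tuple of z.1 :: z.2].
Definition tuncons n (t : n.+1.-tuple RT) : RT * n.-tuple RT := (thead t, [tuple of behead t]).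

Lemma measurable_tcons n : measurable_fun setT (@tcons n).
Proof. exact: measurable_cons. Qed.

Lemma measurable_tuncons n : measurable_fun setT (@tuncons n).
Proof.
apply/measurable_fun_pairP; split.
  exact: measurable_tnth.
exact: measurable_behead.
Qed.

Lemma tconsK n : cancel (@tcons n) (@tuncons n).
Proof.
move=> [x t]; rewrite /tuncons /tcons theadE; congr pair; exact/val_inj.
Qed.

(** The left inverse e' gives e^-1(e'^-1(F_k)) = F_k, so an exhaustion F_k by sets of finite measure
    is carried over to the image. *)
Lemma exists_sigma_finite_pushforward d1 d2 (T1 : measurableType d1) (T2 : measurableType d2)
    (nu : {sigma_finite_measure set T1 -> \bar R}) (e : T1 -> T2) (e' : T2 -> T1) :
  measurable_fun setT e -> measurable_fun setT e' -> cancel e e' ->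
  exists nu' : {sigma_finite_measure set T2 -> \bar R},
    forall f, nnm f -> \int[nu']_x f x = \int[nu]_x f (e x).
Proof.
move=> me me' eK; pose m := pushforward nu e.
have sf : sigma_finite setT m.
  have [F TF Foo] := sigma_finiteT nu.
  exists (fun k => e' @^-1` F k); first by rewrite -preimage_bigcup -TF.
  move=> k; have [mF Fk] := Foo k; split.
    by rewrite -[X in measurable X]setTI; apply: me'.
  rewrite /m /pushforward (_ : _ @^-1` _ = F k)//.
  by apply/seteqP; split=> z /=; rewrite eK.
pose pf : {measure set T2 -> \bar R} := pushforward nu e.
pose H := Measure_isSigmaFinite.Build _ _ _ (pf me) sf.
pose nu' := HB.pack_for {sigma_finite_measure set T2 -> \bar R} (Measure.sort (pf me)) H.
exists nu' => f [mf f0].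
by rewrite (ge0_integral_pushforward me nu measurableT mf).
Qed.

(** Both exhaustions are taken increasing: a pair in F_i x G_j then lies in the diagonal rectangle
    of index max(i, j). *)
Lemma exists_sigma_finite_product d1 d2 (T1 : measurableType d1) (T2 : measurableType d2)
    (m1 : {sigma_finite_measure set T1 -> \bar R})
    (m2 : {sigma_finite_measure set T2 -> \bar R}) :
  exists nu : {sigma_finite_measure set (T1 * T2)%type -> \bar R},
    forall f, nnm f -> \int[nu]_z f z = \int[m1]_x \int[m2]_y f (x, y).
Proof.
pose pf : {measure set (T1 * T2)%type -> \bar R} := m1 \x m2.
have sf : sigma_finite setT pf.
  have /sigma_finiteP[F [TF ndF Foo]] := sigma_finiteT m1.
  have /sigma_finiteP[G [TG ndG Goo]] := sigma_finiteT m2.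
  exists (fun n => F n `*` G n).
    apply/esym/seteqP; split=> // -[x y] _.
    have [i _ Fx] : (\bigcup_k F k) x by rewrite -TF.
    have [j _ Gy] : (\bigcup_k G k) y by rewrite -TG.
    exists (maxn i j) => //; split.
      by move: x Fx; exact/subsetPset/ndF/leq_maxl.
    by move: y Gy; exact/subsetPset/ndG/leq_maxr.
  move=> k; have [mF Fk] := Foo k; have [mG Gk] := Goo k.
  split; first exact: measurableX.
  by rewrite /pf/= product_measure1E// lte_mul_pinfty// ge0_fin_numE.
pose H := Measure_isSigmaFinite.Build _ _ _ pf sf.
pose nu := HB.pack_for {sigma_finite_measure set (T1 * T2)%type -> \bar R} (Measure.sort pf) H.
by exists nu => f [mf f0]; exact: (fubini_tonelli1 f mf f0).
Qed.

(** The iterated integral [intRn] has to come from a sigma-finite measure before Tonelli, null sets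
    and duality can be used. The recursion starts with the point mass at the empty tuple. *)
Lemma exists_tuple_measure n :
  exists nu : {sigma_finite_measure set (n.-tuple RT) -> \bar R},
    forall f : n.-tuple RT -> \bar R, nnm f -> \int[nu]_x f x = @intRn R n f.
Proof.
elim: n => [|n [nu IH]].
  exists (\d_ ([tuple] : 0.-tuple RT)) => f [mf f0].
  by rewrite integral_dirac// diracT mul1e.
have [pr prE] := exists_sigma_finite_product mu nu.
have [nu' nu'E] := exists_sigma_finite_pushforward pr
  (@measurable_tcons n) (@measurable_tuncons n) (@tconsK n).
exists nu' => f nf; rewrite nu'E//.
have nfc : nnm (fun z => f (@tcons n z)) by exact: (nnm_comp (@measurable_tcons n)).
rewrite prE//=; apply: eq_integral => x _.
rewrite -IH//; exact: (nnm_section x nfc).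
Qed.

Definition tuple_measure n := sval (cid (exists_tuple_measure n)).

Lemma tuple_measureE n (f : n.-tuple RT -> \bar R) : nnm f ->
  \int[tuple_measure n]_x f x = @intRn R n f.
Proof. exact: (svalP (cid (exists_tuple_measure n))). Qed.

Lemma tuple_measureS n (f : n.+1.-tuple RT -> \bar R) : nnm f ->
  \int[tuple_measure n.+1]_t f t = \int[mu]_x \int[tuple_measure n]_t f (@tcons n (x, t)).
Proof.
move=> nf; rewrite tuple_measureE//=; apply: eq_integral => x _.
rewrite tuple_measureE//; apply: (nnm_comp (h := fun t => @tcons n (x, t))) nf.
by apply: measurableT_comp; [exact: measurable_tcons|exact: pair1_measurable].
Qed.

End TupleMeasure.

(** * Tensor products of kernels *)

Section Tensor.
Local Open Scope ereal_scope.
Context {R : realType} d1 d2 d1' d2'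
  (S1 : measurableType d1) (S2 : measurableType d2)
  (S1' : measurableType d1') (S2' : measurableType d2').
Variables (m1 : {sigma_finite_measure set S1 -> \bar R})
  (m2 : {sigma_finite_measure set S2 -> \bar R})
  (m1' : {sigma_finite_measure set S1' -> \bar R})
  (m2' : {sigma_finite_measure set S2' -> \bar R}).

(* Apply the bound for K2 to the slices F(x, .) and G(y, .), then the bound for K1
   to their norms: for bilinear forms no Minkowski inequality is needed. *)
Lemma bilinear_bound_tensor (K1 : S1 * S1' -> \bar R) (K2 : S2 * S2' -> \bar R)
    (P m C1 C2 : R) (F : S1 * S2 -> \bar R) (G : S1' * S2' -> \bar R) :
  (0 < P)%R -> (0 < m)%R -> (0 <= C1)%R -> (0 <= C2)%R ->
  nnm K1 -> nnm K2 -> nnm F -> nnm G ->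
  bilinear_bound m1 m1' K1 P m C1 -> bilinear_bound m2 m2' K2 P m C2 ->
  \int[m1]_x \int[m2]_t (F (x, t) *
      \int[m1']_y \int[m2']_s (K1 (x, y) * K2 (t, s) * G (y, s))) <=
  (C1 * C2)%:E * ((\int[m1]_x \int[m2]_t F (x, t) `^ P) `^ P^-1 *
                  (\int[m1']_y \int[m2']_s G (y, s) `^ m) `^ m^-1).
Proof.
move=> P0 m0 C10 C20 nK1 nK2 nF nG B1 B2.
have [[_ K10] [_ F0] [_ G0]] : [/\ nnm K1, nnm F & nnm G] by [].
have PN0 : P != 0%R by rewrite gt_eqF.
have mN0 : m != 0%R by rewrite gt_eqF.
(* J(t, y) is the operator of K2 applied to the slice G(y, .), with y as a parameter. *)
pose J (z : S2 * S1') := \int[m2']_s (K2 (z.1, s) * G (z.2, s)).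
have m11 d d' d'' (A : measurableType d) (B : measurableType d') (C : measurableType d'') :
    measurable_fun setT (fun z : A * B * C => z.1.1).
  exact: (measurableT_comp measurable_fst measurable_fst).
have m12 d d' d'' (A : measurableType d) (B : measurableType d') (C : measurableType d'') :
    measurable_fun setT (fun z : A * B * C => z.1.2).
  exact: (measurableT_comp measurable_snd measurable_fst).
have nJ : nnm J.
  apply: (@nnm_integral_snd _ _ _ _ _ m2' (fun w => K2 (w.1.1, w.2) * G (w.1.2, w.2))).
  apply: nnmM.
    by apply: (nnm_comp (h := fun w => (w.1.1, w.2))) nK2;
      apply: measurable_fun_pair; [exact: m11|exact: measurable_snd].
  by apply: (nnm_comp (h := fun w => (w.1.2, w.2))) nG;
      apply: measurable_fun_pair; [exact: m12|exact: measurable_snd].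
have nJy y : nnm (fun t => J (t, y)).
  by apply: (nnm_comp (h := fun t => (t, y))) nJ; exact: pair2_measurable.
have nGy y : nnm (fun s => G (y, s)) by exact: nnm_section.
have nFx x : nnm (fun t => F (x, t)) by exact: nnm_section.
have [_ J0] := nJ.
have inner x y t : \int[m2']_s (K1 (x, y) * K2 (t, s) * G (y, s)) = K1 (x, y) * J (t, y).
  rewrite -nnm_integralZl//; last by apply: nnmM => //; exact: nnm_section.
  by apply: eq_integral => s _; rewrite muleA.
pose Fn x := (\int[m2]_t F (x, t) `^ P) `^ P^-1.
pose Gn y := (\int[m2']_s G (y, s) `^ m) `^ m^-1.
have nFn : nnm Fn by apply: nnm_poweR; apply: (nnm_integral_snd _ (nnm_poweR P nF)).
have nGn : nnm Gn by apply: nnm_poweR; apply: (nnm_integral_snd _ (nnm_poweR m nG)).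
have step x : \int[m2]_t (F (x, t) *
      \int[m1']_y \int[m2']_s (K1 (x, y) * K2 (t, s) * G (y, s))) <=
    C2%:E * (Fn x * intop m1' K1 Gn x).
  have nK1x : nnm (fun y => K1 (x, y)) by exact: nnm_section.
  have nKJ t : nnm (fun y => K1 (x, y) * J (t, y)) by apply: nnmM => //; exact: nnm_section.
  pose Q (z : S2 * S1') := F (x, z.1) * (K1 (x, z.2) * J z).
  have nQ : nnm Q.
    apply: nnmM; first exact: (nnm_comp measurable_fst (nFx x)).
    by apply: nnmM => //; exact: (nnm_comp measurable_snd nK1x).
  rewrite (eq_integral (fun t => \int[m1']_y Q (t, y))); last first.
    move=> t _; rewrite /Q/= nnm_integralZl//.
    by congr (_ * _); apply: eq_integral => y _; rewrite inner.
  (* Once y is the outer variable, the integral in t is the bilinear form of K2 on the slices F(x,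
     .) and G(y, .), up to the factor K1(x, y). *)
  rewrite tonelli// /intop -nnm_integralZl//; [|exact: nnmM|by case: nFn].
  rewrite -nnm_integralZl ?lee_fin//; last first.
    by apply: nnmM; [apply: nnm_cst; case: nFn|exact: nnmM].
  apply: nnm_le_integral.
  - split=> [|y]; last by apply: integral_ge0 => t _; case: nQ.
    by apply: measurable_fun_fubini_tonelli_G; case: nQ.
  - by apply: nnmM; [exact: nnm_cst|apply: nnmM; [apply: nnm_cst; case: nFn|exact: nnmM]].
  - move=> y; rewrite /Q/=.
    under eq_integral do rewrite muleCA.
    rewrite nnm_integralZl//; last exact: nnmM.
    rewrite [Fn x * _]muleCA [leRHS]muleCA lee_wpmul2l//.
    exact: (B2 _ _ (nFx x) (nGy y)).
apply: (@le_trans _ _ (\int[m1]_x (C2%:E * (Fn x * intop m1' K1 Gn x)))).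
  apply: nnm_le_integral => //.
  - apply: (@nnm_integral_snd _ _ _ _ _ m2 (fun z => F z *
      \int[m1']_y \int[m2']_s (K1 (z.1, y) * K2 (z.2, s) * G (y, s)))).
    apply: nnmM => //.
    apply: (@nnm_integral_snd _ _ _ _ _ m1' (fun w : S1 * S2 * S1' =>
      \int[m2']_s (K1 (w.1.1, w.2) * K2 (w.1.2, s) * G (w.2, s)))).
    have -> : (fun w : S1 * S2 * S1' =>
        \int[m2']_s (K1 (w.1.1, w.2) * K2 (w.1.2, s) * G (w.2, s))) =
      (fun w => K1 (w.1.1, w.2) * J (w.1.2, w.2)).
      by apply/funext => w; rewrite inner.
    apply: nnmM.
      by apply: (nnm_comp (h := fun w => (w.1.1, w.2))) nK1;
      apply: measurable_fun_pair; [exact: m11|exact: measurable_snd].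
    by apply: (nnm_comp (h := fun w => (w.1.2, w.2))) nJ;
      apply: measurable_fun_pair; [exact: m12|exact: measurable_snd].
  - apply: nnmM; first by apply: nnm_cst; rewrite lee_fin.
    by apply: nnmM => //; exact: nnm_intop.
rewrite nnm_integralZl ?lee_fin//; last by apply: nnmM => //; exact: nnm_intop.
rewrite [(C1 * C2)%R]mulrC EFinM -muleA lee_wpmul2l ?lee_fin//.
apply: (le_trans (B1 _ _ nFn nGn)); rewrite le_eqVlt; apply/orP; left; apply/eqP.
congr (_ * (_ `^ _ * _ `^ _)); apply: eq_integral => x _; rewrite -poweRrM mulVf// poweRe1//.
- by apply: integral_ge0 => t _; exact: poweR_ge0.
- by apply: integral_ge0 => t _; exact: poweR_ge0.
Qed.

End Tensor.

(** * The product kernel on tuples *)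

Section TupleKernel.
Context {R : realType}.
Notation RT := (measurableTypeR R).
Notation mu := (@lebesgue_measure R).

Definition riesz_prod (lam tau : R) n (z : n.-tuple RT * n.-tuple RT) : R :=
  \prod_(i < n) riesz1 lam tau (tnth z.1 i, tnth z.2 i).

Lemma nnm_riesz_prod (lam tau : R) n : nnm (fun z => (riesz_prod lam tau z)%:E : \bar R) (T := (n.-tuple RT * n.-tuple RT)%type).
Proof.
apply: nnm_EFin => [|z]; last by apply: prodr_ge0 => i _; rewrite mulr_ge0 ?powR_ge0.
apply: measurable_prod => i _; have [mr _] := nnm_riesz1 lam tau.
apply: (@measurableT_comp _ _ _ _ _ _ (riesz1 lam tau)); first exact/measurable_EFinP.
by apply: measurable_fun_pair;
   [apply: (measurableT_comp (measurable_tnth i) measurable_fst)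
   |apply: (measurableT_comp (measurable_tnth i) measurable_snd)].
Qed.

Lemma riesz_prod_tcons (lam tau : R) n x y (t s : n.-tuple RT) :
  riesz_prod lam tau (tcons (x, t), tcons (y, s)) =
  riesz1 lam tau (x, y) * riesz_prod lam tau (t, s).
Proof.
rewrite /riesz_prod big_ord_recl /= !tnth0; congr (_ * _).
by apply: eq_bigr => i _; rewrite !tnthS.
Qed.

Lemma riesz_prod_bilinear_bound (P m lam tau C : R) n : 0 < P -> 0 < m -> 0 <= C ->
  bilinear_bound mu mu (fun z => (riesz1 lam tau z)%:E) P m C ->
  bilinear_bound (tuple_measure n) (tuple_measure n)
    (fun z => (riesz_prod lam tau z)%:E) P m (C ^+ n).
Proof.
move=> P0 m0 C0 B1.
have PN0 : P != 0%R by rewrite gt_eqF.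
have mN0 : m != 0%R by rewrite gt_eqF.
elim: n => [|n IH] f g nf ng.
  have nK := nnm_riesz_prod lam tau 0.
  have nI := nnmM nf (nnm_intop (tuple_measure 0) nK ng).
  rewrite (tuple_measureE nI) (tuple_measureE (nnm_poweR P nf)) (tuple_measureE (nnm_poweR m ng)).
  rewrite /= /intop (tuple_measureE (nnmM (nnm_section _ nK) ng)) /=.
  rewrite /riesz_prod big_ord0 mul1e expr0 mul1e -!poweRrM !mulfV//.
  by rewrite !poweRe1//; [case: ng|case: nf].
have nK := nnm_riesz_prod lam tau n.+1.
have nfc := nnm_comp (@measurable_tcons R n) nf.
have ngc := nnm_comp (@measurable_tcons R n) ng.
rewrite exprS.
have B := bilinear_bound_tensor P0 m0 C0 (exprn_ge0 n C0) (nnm_riesz1 lam tau)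
  (nnm_riesz_prod lam tau n) nfc ngc B1 IH.
rewrite (tuple_measureS (nnmM nf (nnm_intop _ nK ng))) (tuple_measureS (nnm_poweR P nf)).
rewrite (tuple_measureS (nnm_poweR m ng)).
apply: le_trans B; rewrite le_eqVlt; apply/orP; left; apply/eqP.
apply: eq_integral => x _; apply: eq_integral => t _; congr (_ * _)%E.
rewrite /intop (tuple_measureS (nnmM (nnm_section _ nK) ng)).
apply: eq_integral => y _; apply: eq_integral => s _.
by rewrite riesz_prod_tcons EFinM.
Qed.

End TupleKernel.

(** * Duality *)

Section LpNorm.
Local Open Scope ereal_scope.
Context {R : realType} d (T : measurableType d).
Variable mu : {sigma_finite_measure set T -> \bar R}.
Implicit Types (f g h : T -> \bar R) (r P : R).

Definition lpn r f := (\int[mu]_x f x `^ r) `^ r^-1.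

Lemma lpn_ge0 r f : 0 <= lpn r f. Proof. exact: poweR_ge0. Qed.

Lemma le_poweR (a b : \bar R) r : (0 <= r)%R -> 0 <= a -> a <= b -> a `^ r <= b `^ r.
Proof.
move=> r0 a0 ab; apply: gt0_ler_poweR => //; rewrite in_itv/= leey andbT//.
exact: le_trans ab.
Qed.

Lemma poweR_invK (a : \bar R) r : r != 0%R -> 0 <= a -> (a `^ r) `^ r^-1 = a.
Proof. by move=> r0 a0; rewrite -poweRrM mulfV// poweRe1. Qed.

Lemma poweRVK (a : \bar R) r : r != 0%R -> 0 <= a -> (a `^ r^-1) `^ r = a.
Proof. by move=> r0 a0; rewrite -poweRrM mulVf// poweRe1. Qed.

(** This is the conjugate case for f^r and g^r with the exponents r1/r and r2/r. *)
Lemma lpn_hoelder r1 r2 r f g : (0 < r1)%R -> (0 < r2)%R -> (0 < r)%R ->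
  (r^-1 = r1^-1 + r2^-1)%R -> nnm f -> nnm g ->
  lpn r (fun x => f x * g x) <= lpn r1 f * lpn r2 g.
Proof.
move=> r10 r20 r0 rE nf ng; have [_ f0] := nf; have [_ g0] := ng.
have rN0 : r != 0%R by rewrite gt_eqF.
have r1N0 : r1 != 0%R by rewrite gt_eqF.
have r2N0 : r2 != 0%R by rewrite gt_eqF.
have := nnm_hoelder (p := (r1 / r)%R) (q := (r2 / r)%R) mu _ _ _ (nnm_poweR r nf) (nnm_poweR r ng).
have -> : ((r1 / r)^-1 + (r2 / r)^-1 = 1)%R.
  by rewrite !invf_div -mulrDr -rE mulfV.
move=> /(_ (divr_gt0 r10 r0) (divr_gt0 r20 r0) erefl).
under eq_integral do rewrite -poweRM//.
under [X in _ <= X `^ _ * _]eq_integral do rewrite -poweRrM mulrC divfK//.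
under [X in _ <= _ * X `^ _]eq_integral do rewrite -poweRrM mulrC divfK//.
move=> H; have r'0 : (0 <= r^-1)%R by rewrite invr_ge0 ltW.
have := le_poweR r'0 (nnm_integral_ge0 mu (nnm_poweR r (nnmM nf ng))) H.
have e1 : ((r1 / r)^-1 * r^-1 = r1^-1)%R by rewrite invf_div mulrAC mulfV// mul1r.
have e2 : ((r2 / r)^-1 * r^-1 = r2^-1)%R by rewrite invf_div mulrAC mulfV// mul1r.
by rewrite poweRM ?poweR_ge0// -!poweRrM e1 e2.
Qed.

(** The truncations min(w, k) 1_{E_k} increase to w everywhere, also where w is infinite, so
    monotone convergence applies. They have finite integral when E_k has finite measure. *)
Lemma integral_le_of_trunc (w : T -> \bar R) (E : (set T)^nat) (D : \bar R) :
  nnm w -> nondecreasing_seq E -> (forall k, measurable (E k)) -> \bigcup_k E k = setT ->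
  (forall k, \int[mu]_x (Order.min (w x) k%:R%:E * (\1_(E k) x)%:E) <= D) ->
  \int[mu]_x w x <= D.
Proof.
move=> [mw w0] ndE mE TE H.
pose wk k x := Order.min (w x) k%:R%:E * (\1_(E k) x)%:E.
have wk0 k x : 0 <= wk k x.
  by rewrite mule_ge0// ?lee_fin// le_min w0/= lee_fin.
have mwk k : measurable_fun setT (wk k).
  apply: emeasurable_funM; first by apply: measurable_mine => //; exact: measurable_cst.
  exact/measurable_EFinP.
have ndwk x : nondecreasing_seq (wk ^~ x).
  move=> i j ij; rewrite /wk; apply: lee_pmul.
  - by rewrite le_min w0/= lee_fin.
  - by rewrite lee_fin.
  - by rewrite le_min !ge_min lexx/= lee_fin ler_nat ij orbT.
  - rewrite lee_fin !indicE; case: (boolP (x \in E i)) => // /set_mem xi.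
    by rewrite mem_set//; move: x xi; exact/subsetPset/ndE.
have cvgwk x : wk ^~ x @ \oo --> w x.
  have [i _ Ei] : (\bigcup_k E k) x by rewrite TE.
  have Ej k : (i <= k)%N -> wk k x = Order.min (w x) k%:R%:E.
    move=> ik; rewrite /wk indicE mem_set ?mule1//.
    by move: x Ei; exact/subsetPset/ndE.
  have := w0 x; case wE : (w x) => [a| |]// _.
    apply: cvg_near_cst; near=> k.
    rewrite Ej ?wE; last by near: k; exact: nbhs_infty_ge.
    apply/min_idPl; rewrite lee_fin; near: k.
    exact: nbhs_infty_ger.
  apply/cvgeyPge => A; near=> k.
  rewrite Ej ?wE; last by near: k; exact: nbhs_infty_ge.
  rewrite (min_idPr _) ?leey// lee_fin; near: k.
  exact: nbhs_infty_ger.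
have cv := @cvg_monotone_convergence _ _ _ mu setT measurableT wk mwk
  (fun n x _ => wk0 n x) (fun x _ => ndwk x).
rewrite (eq_integral (fun x => limn (wk ^~ x))); last first.
  by move=> x _; apply/esym/cvg_lim => //; exact: cvgwk.
rewrite -(cvg_lim _ cv)//; apply: lime_le; first by apply/cvg_ex; eexists; exact: cv.
exact: nearW.
Unshelve. all: by end_near. Qed.

(* The test functions are f = w_k^(1/P) with w_k = min(h^r, k) 1_{E_k}, E_k of
   finite measure, so that w_k <= f h. *)
Lemma lpn_le_of_dual h P r (D : \bar R) : (1 < P)%R -> (P^-1 + r^-1 = 1)%R -> nnm h ->
  0 <= D -> (forall f, nnm f -> \int[mu]_x (f x * h x) <= D * lpn P f) ->
  lpn r h <= D.
Proof.
move=> P1 Pr nh D0 H; have [_ h0] := nh.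
have P0 : (0 < P)%R by lra.
have PN0 : P != 0%R by rewrite gt_eqF.
have iP : (P^-1 < 1)%R by rewrite invf_lt1.
have ir0 : (0 < r^-1)%R by lra.
have r0 : (0 < r)%R by rewrite -invr_gt0.
have rN0 : r != 0%R by rewrite gt_eqF.
suff : \int[mu]_x h x `^ r <= D `^ r.
  move=> /(le_poweR (ltW ir0) (nnm_integral_ge0 mu (nnm_poweR r nh))).
  by rewrite (poweR_invK rN0 D0).
case: D D0 H => [e| |]// e0 H; last by rewrite poweRyr// leey.
have /sigma_finiteP[E [TE ndE Eoo]] := sigma_finiteT mu.
have nw := nnm_poweR r nh; have [mw w0] := nw.
apply: (integral_le_of_trunc nw ndE) => [k||k].
- by have [] := Eoo k.
- by rewrite -TE.
have [mEk Ekoo] := Eoo k.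
pose wk x := Order.min (h x `^ r) k%:R%:E * (\1_(E k) x)%:E.
have k0 : 0 <= (k%:R%:E : \bar R) by rewrite lee_fin.
have nind : nnm (fun x => (\1_(E k) x)%:E : \bar R) by apply: nnm_EFin.
have nwk : nnm wk.
  apply: nnmM => //; split=> [|x]; last by rewrite le_min w0.
  by apply: measurable_mine => //; exact: measurable_cst.
have [mwk wk0] := nwk.
have wkw x : wk x <= h x `^ r.
  rewrite /wk indicE; case: (x \in E k); rewrite ?mule1 ?mule0//.
  by rewrite ge_min lexx.
have Aoo : \int[mu]_x wk x < +oo.
  apply: (@le_lt_trans _ _ (\int[mu]_x (k%:R%:E * (\1_(E k) x)%:E))).
    apply: nnm_le_integral => //; first by apply: nnmM => //; exact: nnm_cst.
    by move=> x; rewrite lee_wpmul2r ?lee_fin// ge_min lexx orbT.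
  by rewrite nnm_integralZl// integral_indic// setIT lte_mul_pinfty.
have := H _ (nnm_poweR P^-1 nwk).
rewrite /lpn; under [X in _ <= _ * X `^ _]eq_integral do rewrite (poweRVK PN0)//.
have le1 : \int[mu]_x wk x <= \int[mu]_x (wk x `^ P^-1 * h x).
  apply: nnm_le_integral => //; first by apply: nnmM => //; exact: nnm_poweR.
  move=> x; have wE : wk x = wk x `^ P^-1 * wk x `^ r^-1.
    rewrite -poweRD ?Pr ?poweRe1// /poweRD_def; apply/implyP => /eqP.
    by rewrite Pr => /eqP; rewrite oner_eq0.
  rewrite [leLHS]wE lee_wpmul2l ?poweR_ge0//.
  by rewrite -[leRHS](poweR_invK rN0 (h0 x)) le_poweR// ltW.
move=> /(le_trans le1); move: (nnm_integral_ge0 mu nwk) Aoo; rewrite -/wk.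
case: (\int[mu]_x wk x) => [A| |]//; rewrite lee_fin => A0 _.
rewrite !poweR_EFin -EFinM !lee_fin => AeA.
(* The truncation made A, the integral of w_k, finite: this is what permits dividing A <= D A^(1/P)
   by A^(1/P). *)
move: A0; rewrite le_eqVlt => /predU1P[<-|A0]; first exact: powR_ge0.
have AE : (A = A `^ P^-1 * A `^ r^-1)%R by rewrite -powRD ?Pr ?powRr1 ?ltW// oner_eq0.
have AP0 : (0 < A `^ P^-1)%R by exact: powR_gt0.
move: AeA; rewrite {1}AE mulrC ler_pM2r// => Ae.
have -> : A = ((A `^ r^-1) `^ r)%R by rewrite -powRrM mulVf// powRr1// ltW.
by rewrite ge0_ler_powR ?nnegrE ?powR_ge0 ?(ltW r0).
Qed.

Lemma lpn_lty r f : r != 0%R -> (lpn r f < +oo) = (\int[mu]_x f x `^ r < +oo).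
Proof.
move=> r0; apply/idP/idP; last exact: poweR_lty.
by apply: lty_poweRy; rewrite invr_eq0.
Qed.

End LpNorm.

(** * From bilinear bounds to operator bounds *)

Section OperatorBound.
Local Open Scope ereal_scope.
Context {R : realType} d (T : measurableType d).
Variable mu : {sigma_finite_measure set T -> \bar R}.

Definition operator_bound (K : T * T -> \bar R) (m r C : R) :=
  forall g, nnm g -> lpn mu r (intop mu K g) <= C%:E * lpn mu m g.

Lemma operator_bound_of_bilinear K (P m r C : R) : (1 < P)%R -> (P^-1 + r^-1 = 1)%R ->
  (0 <= C)%R -> nnm K -> bilinear_bound mu mu K P m C -> operator_bound K m r C.
Proof.
move=> P1 Pr C0 nK B g ng; apply: (lpn_le_of_dual P1 Pr); first exact: nnm_intop.
  by rewrite mule_ge0 ?lpn_ge0.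
by move=> f nf; rewrite muleAC -muleA; exact: B.
Qed.

End OperatorBound.

(** * Regularity lifting *)

Section LevelSets.
Context {R : realType} d (T : measurableType d).
Variable u : T -> R.
Hypotheses (mu_ : measurable_fun setT u) (u0 : forall x, 0 < u x).

Definition level_set (n : nat) : set T := [set x | n.+1%:R^-1 <= u x <= n.+1%:R].

Lemma measurable_level_set n : measurable (level_set n).
Proof.
rewrite (_ : level_set n = u @^-1` `[n.+1%:R^-1, n.+1%:R]%classic).
  by rewrite -[X in measurable X]setTI; apply: mu_.
by apply/seteqP; split=> x /=; rewrite in_itv.
Qed.

Lemma nondecreasing_level_set : nondecreasing_seq level_set.
Proof.
move=> i j ij; apply/subsetPset => x /= /andP[iu ui]; apply/andP; split.
  by apply: le_trans iu; rewrite lef_pV2 ?posrE// ler_nat ltnS.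
by apply: (le_trans ui); rewrite ler_nat ltnS.
Qed.

Lemma bigcup_level_set : \bigcup_n level_set n = setT.
Proof.
apply/seteqP; split=> // x _.
pose n := maxn (Num.truncn (u x)) (Num.truncn (u x)^-1).
exists n => //=; apply/andP; split.
  rewrite -[leRHS]invrK lef_pV2 ?posrE ?invr_gt0//.
  by apply: ltW; apply: (lt_le_trans (truncnS_gt _)); rewrite ler_nat ltnS leq_maxr.
by apply: ltW; apply: (lt_le_trans (truncnS_gt _)); rewrite ler_nat ltnS leq_maxl.
Qed.

(** On a level set all powers are comparable, because a^(r - r0) is at most L^|r - r0|.
    Integrability of one power thus gives all of them there. *)
Lemma powR_level_le (L a r r0 : R) : 1 <= L -> L^-1 <= a -> a <= L ->
  a `^ r <= L `^ `|r - r0| * a `^ r0.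
Proof.
move=> L1 La aL; have L0 : 0 < L by exact: lt_le_trans L1.
have a0 : 0 < a by apply: lt_le_trans La; rewrite invr_gt0.
have -> : a `^ r = a `^ (r - r0) * a `^ r0.
  by rewrite -powRD ?subrK// (gt_eqF a0) implybT.
rewrite ler_wpM2r ?powR_ge0//; have [rr|rr] := leP r0 r.
  by rewrite ger0_norm ?subr_ge0// ge0_ler_powR ?nnegrE ?subr_ge0 ?(ltW a0) ?(ltW L0).
rewrite ltr0_norm ?subr_lt0//.
have -> : L `^ (- (r - r0)) = (L^-1) `^ (r - r0).
  by rewrite -powR_inv1 ?(ltW L0)// -powRrM mulN1r.
have -> : r - r0 = - (r0 - r) by rewrite opprB.
by apply: ge0_ler_powRN; rewrite ?subr_ge0 ?(ltW rr) ?invr_gt0.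
Qed.

End LevelSets.

Section Lifting.
Local Open Scope ereal_scope.
Context {R : realType} d (T : measurableType d).
Variable mu : {sigma_finite_measure set T -> \bar R}.

Lemma integral_powR_level_set_lty (u : T -> R) (r r0 : R) n :
  measurable_fun setT u -> (forall x, (0 < u x)%R) ->
  \int[mu]_x (u x)%:E `^ r0 < +oo ->
  \int[mu]_(x in level_set u n) (u x)%:E `^ r < +oo.
Proof.
move=> mu_ u0 Ioo; have nu := nnm_EFin mu_ (fun x => ltW (u0 x)).
have mE := measurable_level_set mu_ n.
have [mr _] := nnm_poweR r nu; have [mr0 u00] := nnm_poweR r0 nu.
apply: (@le_lt_trans _ _ (\int[mu]_(x in level_set u n)
    ((n.+1%:R `^ `|r - r0|)%:E * (u x)%:E `^ r0))).
  apply: ge0_le_integral => //.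
  - by move=> x _; exact: poweR_ge0.
  - by apply: measurable_funTS; exact: mr.
  - by apply: measurable_funTS; apply: emeasurable_funM => //; exact: mr0.
  - move=> x /andP[Lu uL]; rewrite !poweR_EFin -EFinM lee_fin.
    by apply: powR_level_le => //; rewrite ler1n.
rewrite ge0_integralZl//; last by apply: measurable_funTS; exact: mr0.
rewrite lte_mul_pinfty ?lee_fin ?powR_ge0//.
by apply: le_lt_trans Ioo; exact: ge0_subset_integral.
Qed.

Lemma poweRD_le (a b : \bar R) (r : R) : (0 < r)%R -> 0 <= a -> 0 <= b ->
  (a + b) `^ r <= (2 `^ r)%:E * (a `^ r + b `^ r).
Proof.
move=> r0 a0 b0; have r0' := ltW r0.
wlog ab : a b a0 b0 / a <= b.
  move=> H; have /orP[ab|ba] := le_total a b; first exact: H.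
  by rewrite addeC [X in _ * X]addeC; exact: H.
apply: (@le_trans _ _ ((2%:E * b) `^ r)).
  by apply: le_poweR => //; [exact: adde_ge0|rewrite mule_natl mule2n leeD2r].
rewrite poweRM// ?lee_fin// poweR_EFin lee_wpmul2l ?lee_fin ?powR_ge0//.
by rewrite leeDr// poweR_ge0.
Qed.

(* The partial sums [U_k] of the Neumann series of [u = S u + F] are bounded in
   L^r, while the remainders [S^k u] tend to 0 in L^(r0); hence u is in L^r. *)
Lemma regularity_lifting (S : (T -> \bar R) -> T -> \bar R) (u : T -> R)
    (F : T -> \bar R) (r r0 : R) :
  (1 <= r)%R -> (1 <= r0)%R ->
  (forall w, nnm w -> nnm (S w)) ->
  (forall w w', nnm w -> nnm w' -> S (fun x => w x + w' x) = fun x => S w x + S w' x) ->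
  (forall w, nnm w -> lpn mu r (S w) <= 4^-1%:E * lpn mu r w) ->
  (forall w, nnm w -> lpn mu r0 (S w) <= 4^-1%:E * lpn mu r0 w) ->
  measurable_fun setT u -> (forall x, (0 < u x)%R) ->
  nnm F -> (forall x, (u x)%:E = S (fun y => (u y)%:E) x + F x) ->
  \int[mu]_x (u x)%:E `^ r0 < +oo -> \int[mu]_x F x `^ r < +oo ->
  \int[mu]_x (u x)%:E `^ r < +oo.
Proof.
move=> r1 r01 nS SD Sr Sr0 mu_ u0 nF uE Iu IF.
have nu := nnm_EFin mu_ (fun x => ltW (u0 x)).
have rgt0 : (0 < r)%R by exact: lt_le_trans r1.
have r0gt0 : (0 < r0)%R by exact: lt_le_trans r01.
(* The contraction constant 1/4 pays for the factor 2^e of [poweRD_le] and still leaves (2/4)^e <=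
   1/2, since e >= 1. *)
have quarter e w : (1 <= e)%R -> nnm w ->
    lpn mu e (S w) <= 4^-1%:E * lpn mu e w ->
    (2 `^ e)%:E * \int[mu]_x S w x `^ e <= 2^-1%:E * \int[mu]_x w x `^ e.
  move=> e1 nw; have e0 : (0 < e)%R by exact: lt_le_trans e1.
  have eN0 : e != 0%R by rewrite gt_eqF.
  have I0 := nnm_integral_ge0 mu (nnm_poweR e (nS _ nw)).
  have I0' := nnm_integral_ge0 mu (nnm_poweR e nw).
  move=> /(le_poweR (ltW e0) (lpn_ge0 _ _ _)).
  rewrite /lpn poweRM ?lpn_ge0 ?lee_fin// !(poweRVK eN0)// poweR_EFin => H.
  have c0 : 0 <= (2 `^ e)%:E :> \bar R by rewrite lee_fin powR_ge0.
  apply: (le_trans (lee_wpmul2l c0 H)).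
  rewrite muleA -EFinM lee_wpmul2r// lee_fin -powRM//.
  have -> : (2 * 4^-1 = 2^-1 :> R)%R by lra.
  have h2 : (0 < (2^-1 : R) <= 1)%R by apply/andP; split; lra.
  by apply: ge1r_powR.
pose U := fix U k := if k is k'.+1 then (fun x => S (U k') x + F x) else (fun _ => 0).
pose W k := iter k S (fun x => (u x)%:E).
have nU k : nnm (U k).
  by elim: k => [|k IH]; [exact: nnm_cst|apply: nnmD => //; exact: nS].
have nW k : nnm (W k) by elim: k => [|k IH] //; exact: nS.
have UW k : (fun x => (u x)%:E) = fun x => U k x + W k x.
  elim: k => [|k IH]; first by apply/funext => x; rewrite /= add0e.
  apply/funext => x; rewrite uE IH SD//=.
  by rewrite -addeA [S (W k) x + _]addeC addeA.
pose c := (2 `^ r)%:E : \bar R.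
have c0 : 0 <= c by rewrite lee_fin powR_ge0.
(* C0 is the fixed point of z |-> z/2 + c I with I the integral of F^r, the recursion that bounds
   the integrals of U_k^r. *)
pose C0 := 2%:E * (c * \int[mu]_x F x `^ r).
have IF0 := nnm_integral_ge0 mu (nnm_poweR r nF).
have C00 : 0 <= C0 by rewrite !mule_ge0.
have C0oo : C0 < +oo by rewrite !lte_mul_pinfty ?mule_ge0.
have IU k : \int[mu]_x U k x `^ r <= C0.
  elim: k => [|k IH].
    by rewrite integral0_eq// => x _; rewrite poweR0r// gt_eqF.
  apply: (@le_trans _ _ (\int[mu]_x (c * (S (U k) x `^ r + F x `^ r)))).
    apply: nnm_le_integral; first exact: nnm_poweR.
      by apply: nnmM; [exact: nnm_cst|apply: nnmD; apply: nnm_poweR => //; exact: nS].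
    by move=> x; apply: poweRD_le => //; [case: (nS _ (nU k))|case: nF].
  have nSr : nnm (fun x => S (U k) x `^ r) by apply: nnm_poweR; exact: nS.
  have nFr := nnm_poweR r nF.
  rewrite nnm_integralZl//; last exact: nnmD.
  rewrite nnm_integralD// ge0_muleDr//; last exact: nnm_integral_ge0.
  apply: (@le_trans _ _ (2^-1%:E * C0 + c * \int[mu]_x F x `^ r)).
    apply: leeD => //; apply: (le_trans (quarter _ _ r1 (nU k) (Sr _ (nU k)))).
    by rewrite lee_wpmul2l// lee_fin.
  by rewrite /C0 muleA -EFinM mulVf// mul1e mule_natl mule2n.
have Iu0 := nnm_integral_ge0 mu (nnm_poweR r0 nu).
have IW k : \int[mu]_x W k x `^ r0 <= (2^-1 ^+ k)%:E * \int[mu]_x (u x)%:E `^ r0.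
  elim: k => [|k IH]; first by rewrite expr0 mul1e.
  have := quarter _ _ r01 (nW k) (Sr0 _ (nW k)) => Q.
  apply: (@le_trans _ _ ((2 `^ r0)%:E * \int[mu]_x S (W k) x `^ r0)).
    have nSW := nnm_integral_ge0 mu (nnm_poweR r0 (nS _ (nW k))).
    rewrite -[leLHS]mul1e lee_wpmul2r// lee_fin.
    by rewrite -[leLHS](powRr0 2) ler_powR ?ler1n// ltW.
  apply: (le_trans Q); rewrite exprS EFinM -muleA.
  by apply: lee_wpmul2l; [rewrite lee_fin|exact: IH].
pose E := level_set u.
have mE n : measurable (E n) by exact: measurable_level_set.
have [mur ur0] := nnm_poweR r nu.
have IE n : \int[mu]_(x in E n) (u x)%:E `^ r <= c * C0.
  pose L : R := n.+1%:R.
  pose D := (L `^ `|r - r0| * 2 `^ r0)%:E : \bar R.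
  have D0 : 0 <= D by rewrite lee_fin mulr_ge0 ?powR_ge0.
  have bound k : \int[mu]_(x in E n) (u x)%:E `^ r <=
      c * C0 + D * ((2^-1 ^+ k)%:E * \int[mu]_x (u x)%:E `^ r0).
    have [mUr Ur0] := nnm_poweR r (nU k); have [mWr Wr0] := nnm_poweR r0 (nW k).
    have n1 : nnm (fun x => c * U k x `^ r) by apply: nnmM => //; exact: nnm_cst.
    have n2 : nnm (fun x => D * W k x `^ r0) by apply: nnmM => //; exact: nnm_cst.
    have n12 := nnmD n1 n2; have [mn12 n120] := n12.
    apply: (@le_trans _ _ (\int[mu]_(x in E n) (c * U k x `^ r + D * W k x `^ r0))).
      apply: ge0_le_integral => //.
      - by apply: measurable_funTS; exact: mur.
      - by apply: measurable_funTS; exact: mn12.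
      - move=> x /andP[Lu uL].
        have uUW : (u x)%:E = U k x + W k x by have := congr1 (fun f => f x) (UW k).
        have [_ /(_ x) Uk0] := nU k; have [_ /(_ x) Wk0] := nW k.
        (* The larger of U_k and W_k is at least u/2. If it is W_k, which is controlled only in
           L^r0, the power r of u is first traded for r0 on the level set. *)
        have /orP[WU|UWk] := le_total (W k x) (U k x).
          rewrite -[leLHS]adde0 leeD//; last by rewrite mule_ge0.
          rewrite /c -[(2 `^ r)%:E]poweR_EFin -poweRM// uUW.
          apply: le_poweR; [exact: ltW|exact: adde_ge0|by rewrite mule_natl mule2n leeD2l].
        rewrite -[leLHS]add0e leeD//; first by rewrite mule_ge0.
        apply: (@le_trans _ _ ((L `^ `|r - r0|)%:E * (u x)%:E `^ r0)).
          by rewrite !poweR_EFin -EFinM lee_fin; apply: powR_level_le => //; rewrite ler1n.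
        rewrite /D EFinM -muleA lee_wpmul2l ?lee_fin ?powR_ge0//.
        rewrite -[(2 `^ r0)%:E]poweR_EFin -poweRM// uUW.
        apply: le_poweR; [exact: ltW|exact: adde_ge0|by rewrite mule_natl mule2n leeD2r].
    apply: (@le_trans _ _ (\int[mu]_x (c * U k x `^ r + D * W k x `^ r0))).
      by apply: ge0_subset_integral.
    rewrite nnm_integralD//; apply: leeD.
      by rewrite nnm_integralZl; [rewrite lee_wpmul2l|split|].
    by rewrite nnm_integralZl; [rewrite lee_wpmul2l|split|].
  have M0 := nnm_integral_ge0 mu (nnm_poweR r0 nu).
  move: bound Iu M0; case: (\int[mu]_x (u x)%:E `^ r0) => [M| |]// bound _ _.
  (* The left-hand side is independent of k, so the term with 2^(-k) can be made smaller than any e.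
     The remaining bound c C0 is uniform in n. *)
  apply/lee_addgt0Pr => e e0.
  pose Dr : R := (L `^ `|r - r0| * 2 `^ r0)%R.
  pose k := (Num.truncn (Dr * M / e)).+1.
  apply: (le_trans (bound k)); rewrite leeD2l// -!EFinM lee_fin -/Dr.
  have kL : (Dr * M / e < 2 ^+ k)%R.
    apply: (lt_trans (truncnS_gt _)); rewrite -/k -natrX ltr_nat; exact: ltn_expl.
  rewrite mulrCA exprVn mulrC ler_pdivrMr ?exprn_gt0//.
  by rewrite [leRHS]mulrC -ler_pdivrMr// ltW.
apply: (@le_lt_trans _ _ (c * C0)); last by rewrite lte_mul_pinfty.
rewrite -(bigcup_level_set u0); apply: nnm_integral_bigcup_le => //.
exact: nondecreasing_level_set.
Qed.

End Lifting.

(** * Lifting for a system of two integral equations *)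

Section IntegralSystem.
Local Open Scope ereal_scope.
Context {R : realType} d (T : measurableType d).
Variable mu : {sigma_finite_measure set T -> \bar R}.

Lemma integral_mul_indic (h : T -> \bar R) (D : set T) :
  \int[mu]_x (h x * (\1_D x)%:E) = \int[mu]_(x in D) h x.
Proof.
rewrite [RHS]integral_mkcond; apply: eq_integral => x _.
by rewrite patchE indicE; case: (x \in D); rewrite ?mule1 ?mule0.
Qed.

(** If every complement carried more than delta, the integrals over the level sets would stay below
    I - delta, with I the finite total, while they increase to I. *)
Lemma integral_setC_level_set_small (v : T -> R) (s delta : R) :
  measurable_fun setT v -> (forall x, (0 < v x)%R) ->
  \int[mu]_x (v x)%:E `^ s < +oo -> (0 < delta)%R ->
  exists n, \int[mu]_(x in ~` level_set v n) (v x)%:E `^ s <= delta%:E.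
Proof.
move=> mv v0 Ioo d0; have nv := nnm_EFin mv (fun x => ltW (v0 x)).
have nvs := nnm_poweR s nv; have [mvs vs0] := nvs.
have mE n := measurable_level_set mv n.
have I0 := nnm_integral_ge0 mu nvs.
apply: contrapT => /forallNP H.
have IE n : \int[mu]_(x in level_set v n) (v x)%:E `^ s +
    \int[mu]_(x in ~` level_set v n) (v x)%:E `^ s = \int[mu]_x (v x)%:E `^ s.
  rewrite -ge0_integral_setU ?setUv//; first exact: measurableC.
  exact/disj_setPCl.
have : \int[mu]_x (v x)%:E `^ s <= \int[mu]_x (v x)%:E `^ s - delta%:E.
  rewrite -{1}(bigcup_level_set v0); apply: nnm_integral_bigcup_le => //.
    exact: nondecreasing_level_set.
  move=> n; rewrite leeBrDr// -(IE n) leeD2l//.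
  by move: (H n) => /negP; rewrite -ltNge => /ltW.
move: I0 Ioo; case: (\int[mu]_x _) => [I| |]// _ _.
by rewrite -EFinB lee_fin; lra.
Qed.

Lemma integral_level_set_power_lty (v : T -> R) (s e m : R) n :
  measurable_fun setT v -> (forall x, (0 < v x)%R) -> m != 0%R ->
  \int[mu]_x (v x)%:E `^ s < +oo ->
  \int[mu]_x (((v x)%:E `^ e * (\1_(level_set v n) x)%:E) `^ m) < +oo.
Proof.
move=> mv v0 m0 Ioo.
rewrite (eq_integral (fun x => (v x)%:E `^ (e * m) * (\1_(level_set v n) x)%:E)).
  by rewrite integral_mul_indic; exact: (integral_powR_level_set_lty _ _ mv v0 Ioo).
move=> x _; rewrite indicE poweRrM; case: (x \in _); rewrite ?mule1//.
by rewrite !mule0 poweR0r.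
Qed.

Variables (K1 K2 : T * T -> \bar R) (u v : T -> R) (p q : R).
Hypotheses (nK1 : nnm K1) (nK2 : nnm K2).
Hypotheses (mu_ : measurable_fun setT u) (mv : measurable_fun setT v).
Hypotheses (u0 : forall x, (0 < u x)%R) (v0 : forall x, (0 < v x)%R).
Hypotheses (p1 : (1 < p)%R) (q1 : (1 < q)%R).
Hypothesis uE : forall x, (u x)%:E = intop mu K1 (fun y => (v y)%:E `^ q) x.
Hypothesis vE : forall x, (v x)%:E = intop mu K2 (fun y => (u y)%:E `^ p) x.

(* S w = K1 (V K2 (u^(p-1) w)), where V is v^(q-1) cut off to the set where v is
   very large or very small; by absolute continuity S has small norm. *)
Lemma integral_system_lifting (r0 s0 r s m1 m10 m2 m20 C1 C10 C2 C20 : R) :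
  (1 <= r0)%R -> (1 <= r)%R -> (0 < s0)%R -> (0 < s)%R ->
  (0 < m1)%R -> (0 < m10)%R -> (0 < m2)%R -> (0 < m20)%R ->
  (m1^-1 = (q - 1) / s0 + s^-1)%R -> (m10^-1 = (q - 1) / s0 + s0^-1)%R ->
  (m2^-1 = (p - 1) / r0 + r^-1)%R -> (m20^-1 = (p - 1) / r0 + r0^-1)%R ->
  (0 <= C1)%R -> (0 <= C10)%R -> (0 <= C2)%R -> (0 <= C20)%R ->
  operator_bound mu K1 m1 r C1 -> operator_bound mu K1 m10 r0 C10 ->
  operator_bound mu K2 m2 s C2 -> operator_bound mu K2 m20 s0 C20 ->
  \int[mu]_x (u x)%:E `^ r0 < +oo -> \int[mu]_x (v x)%:E `^ s0 < +oo ->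
  \int[mu]_x (u x)%:E `^ r < +oo.
Proof.
move=> r01 r1 s00 s_0 m1_0 m10_0 m2_0 m20_0 m1E m10E m2E m20E C1_0 C10_0 C2_0 C20_0.
move=> B1 B10 B2 B20 Iu Iv.
have r0_0 : (0 < r0)%R by exact: lt_le_trans r01.
have r_0 : (0 < r)%R by exact: lt_le_trans r1.
have nu := nnm_EFin mu_ (fun x => ltW (u0 x)).
have nv := nnm_EFin mv (fun x => ltW (v0 x)).
have q10 : (0 < q - 1)%R by rewrite subr_gt0.
have p10 : (0 < p - 1)%R by rewrite subr_gt0.
(* These are the exponents for which v^(q-1) and u^(p-1) have finite norm, by the integrability of v
   in L^s0 and u in L^r0. *)
pose eV := (s0 / (q - 1))%R; pose eU := (r0 / (p - 1))%R.
have eV0 : (0 < eV)%R by rewrite divr_gt0.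
have eU0 : (0 < eU)%R by rewrite divr_gt0.
have eVN0 : eV != 0%R by rewrite gt_eqF.
have eUN0 : eU != 0%R by rewrite gt_eqF.
have ieV0 : (0 <= eV^-1)%R by rewrite invr_ge0 ltW.
have eVV : ((q - 1) / s0 = eV^-1)%R by rewrite /eV invf_div.
have eUV : ((p - 1) / r0 = eU^-1)%R by rewrite /eU invf_div.
pose U x := (u x)%:E `^ (p - 1).
have nU : nnm U by exact: nnm_poweR.
have lpnU : lpn mu eU U \is a fin_num.
  rewrite (ge0_fin_numE (lpn_ge0 mu eU U)) (lpn_lty mu U eUN0).
  under eq_integral do rewrite /U -poweRrM /eU mulrC divfK ?gt_eqF//.
  exact: Iu.
have [MU MU0 MUE] : exists2 M : R, (0 <= M)%R & lpn mu eU U = M%:E.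
  by exists (fine (lpn mu eU U)); [rewrite fine_ge0// lpn_ge0|rewrite fineK].
have Uu x : U x * (u x)%:E = (u x)%:E `^ p.
  by rewrite /U !poweR_EFin -EFinM mulrC mulr_powRB1 ?(ltW (u0 x))// (lt_trans ltr01).
clear lpnU; clearbody U.
(* The norm MU of u^(p-1) is finite but not small. Smallness comes from V alone, and one eta serves
   both pairs of exponents. *)
have [eta eta0 [small1 small2]] : exists2 eta : R, (0 < eta)%R &
    (C1 * C2 * MU * eta <= 4^-1 /\ C10 * C20 * MU * eta <= 4^-1)%R.
  pose A := (C1 * C2 * MU + C10 * C20 * MU + 1)%R.
  have A1 : (0 <= C1 * C2 * MU)%R by rewrite !mulr_ge0.
  have A2 : (0 <= C10 * C20 * MU)%R by rewrite !mulr_ge0.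
  have A0 : (0 < A)%R by rewrite /A; lra.
  have small_of (x : R) : (x <= A)%R -> (x * (4^-1 / A) <= 4^-1)%R.
    by move=> xA; rewrite mulrCA ler_piMr// ler_pdivrMr// mul1r.
  by exists (4^-1 / A)%R; [rewrite divr_gt0|split; apply: small_of; rewrite /A; lra].
have [n nE] := integral_setC_level_set_small mv v0 Iv (powR_gt0 eV eta0).
have mE := measurable_level_set mv n.
pose V x := (v x)%:E `^ (q - 1) * (\1_(~` level_set v n) x)%:E.
have nind (D : set T) : measurable D -> nnm (fun x => (\1_D x)%:E : \bar R).
  by move=> mD; apply: nnm_EFin.
have nV : nnm V.
  by apply: nnmM; [exact: nnm_poweR|apply: nind; exact: measurableC].
have VE : \int[mu]_x V x `^ eV = \int[mu]_(x in ~` level_set v n) (v x)%:E `^ s0.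
  rewrite -[RHS]integral_mul_indic; apply: eq_integral => x _; rewrite /V indicE.
  case: (x \in _); rewrite ?mule1 ?mule0; last by rewrite poweR0r.
  by rewrite -poweRrM /eV mulrC divfK// gt_eqF.
have lpnV : lpn mu eV V <= eta%:E.
  have eeta0 : 0 <= eta%:E by rewrite lee_fin ltW.
  rewrite -[leRHS](poweR_invK eVN0 eeta0); apply: (le_poweR ieV0).
    by apply: nnm_integral_ge0; exact: nnm_poweR.
  by rewrite VE poweR_EFin.
(* On the level set every power of v is integrable, so W lies in L^m1 and F = K1 W in L^r. *)
pose W x := (v x)%:E `^ q * (\1_(level_set v n) x)%:E.
have nW : nnm W by apply: nnmM; [exact: nnm_poweR|exact: nind].
have IW : lpn mu m1 W < +oo.
  have m1N0 : m1 != 0%R by rewrite gt_eqF.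
  by rewrite (lpn_lty mu W m1N0); exact: (integral_level_set_power_lty _ _ mv v0 m1N0 Iv).
have VW x : V x * (v x)%:E + W x = (v x)%:E `^ q.
  rewrite /V /W !indicE in_setC.
  case: (x \in _); rewrite /= ?mule1 ?mule0 ?mul0e ?add0e ?adde0//.
  by rewrite -EFinM mulrC mulr_powRB1 ?(ltW (v0 x))// (lt_trans ltr01).
clear VE nE mE nind; clearbody V W eU eV.
pose J w := intop mu K2 (fun z => U z * w z).
have nJ w : nnm w -> nnm (J w) by move=> nw; exact: (nnm_intop mu nK2 (nnmM nU nw)).
have JD w w' : nnm w -> nnm w' -> J (fun x => w x + w' x) = fun x => J w x + J w' x.
  move=> nw nw'; have [_ w0] := nw; have [_ w'0] := nw'; apply/funext => x.
  rewrite /J -(intopD mu x nK2 (nnmM nU nw) (nnmM nU nw')).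
  by congr intop; apply/funext => z; rewrite ge0_muleDr.
have Ju : J (fun y => (u y)%:E) = fun y => (v y)%:E.
  by apply/funext => y; rewrite vE; congr intop; apply/funext => z; exact: Uu.
have Jbound c b (e C' : R) w : (0 < c)%R -> (0 < e)%R -> (0 <= C')%R ->
    (c^-1 = eU^-1 + e^-1)%R -> operator_bound mu K2 c b C' -> nnm w ->
    lpn mu b (J w) <= C'%:E * (MU%:E * lpn mu e w).
  move=> c0 e0 C'_0 cE O2 nw; apply: (le_trans (O2 _ (nnmM nU nw))).
  by apply: lee_wpmul2l; [rewrite lee_fin|rewrite -MUE; exact: lpn_hoelder].
clearbody J; clear Uu nU.
pose S w := intop mu K1 (fun y => V y * J w y).
have nVJ w : nnm w -> nnm (fun y => V y * J w y).
  by move=> nw; exact: (nnmM nV (nJ _ nw)).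
have Sbound (a b c e C C' : R) : (0 < a)%R -> (0 < b)%R -> (0 < c)%R -> (0 < e)%R ->
    (0 <= C)%R -> (0 <= C')%R -> (a^-1 = eV^-1 + b^-1)%R -> (c^-1 = eU^-1 + e^-1)%R ->
    operator_bound mu K1 a e C -> operator_bound mu K2 c b C' ->
    (C * C' * MU * eta <= 4^-1)%R ->
    forall w, nnm w -> lpn mu e (S w) <= 4^-1%:E * lpn mu e w.
  move=> a0 b0 c0 e0 C_0 C'_0 aE cE O1 O2 small w nw.
  apply: (le_trans (O1 _ (nVJ _ nw))).
  apply: (@le_trans _ _ (C%:E * (eta%:E * (C'%:E * (MU%:E * lpn mu e w))))).
    apply: lee_wpmul2l; first by rewrite lee_fin.
    apply: (le_trans (lpn_hoelder mu eV0 b0 a0 aE nV (nJ _ nw))).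
    apply: lee_pmul; [exact: lpn_ge0|exact: lpn_ge0|exact: lpnV|].
    exact: (Jbound c b e C').
  rewrite !muleA -!EFinM; apply: lee_wpmul2r; first exact: lpn_ge0.
  rewrite lee_fin; apply: le_trans small; rewrite le_eqVlt; apply/orP; left; apply/eqP; ring.
have S1 := Sbound m1 s m2 r C1 C2 m1_0 s_0 m2_0 r_0 C1_0 C2_0.
have S2 := Sbound m10 s0 m20 r0 C10 C20 m10_0 s00 m20_0 r0_0 C10_0 C20_0.
rewrite -eVV -eUV in S1 S2.
have {}S1 := S1 m1E m2E B1 B2 small1.
have {}S2 := S2 m10E m20E B10 B20 small2.
have nF : nnm (intop mu K1 W) by exact: nnm_intop.
have nS w : nnm w -> nnm (S w) by move=> nw; exact: (nnm_intop mu nK1 (nVJ _ nw)).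
have SD w w' : nnm w -> nnm w' -> S (fun x => w x + w' x) = fun x => S w x + S w' x.
  move=> nw nw'; apply/funext => x.
  rewrite /S -(intopD mu x nK1 (nVJ _ nw) (nVJ _ nw')).
  have [_ Jw0] := nJ _ nw; have [_ Jw'0] := nJ _ nw'.
  by congr intop; apply/funext => y; rewrite JD// ge0_muleDr.
have uSF x : (u x)%:E = S (fun y => (u y)%:E) x + intop mu K1 W x.
  rewrite [LHS]uE /S -(intopD mu x nK1 (nVJ _ nu) nW).
  by congr intop; apply/funext => y; rewrite Ju VW.
have IF : \int[mu]_x intop mu K1 W x `^ r < +oo.
  have rN0 : r != 0%R by rewrite gt_eqF.
  rewrite -(lpn_lty mu _ rN0); apply: (le_lt_trans (B1 _ nW)).
  by apply: lte_mul_pinfty; [rewrite lee_fin| |exact: IW].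
exact: (regularity_lifting r1 r01 nS SD S1 S2 mu_ u0 nF uSF Iu IF).
Qed.

End IntegralSystem.

(** * The Riesz kernel on R^n *)

Section RieszKernel.
Context {R : realType}.
Notation RT := (measurableTypeR R).
Notation mu := (@lebesgue_measure R).

(** Coordinate hyperplanes must be discarded when kernels are compared: where x_i = y_i a factor of
    the product kernel is 0 to a negative power, hence 0, and the domination can fail. *)
Lemma tuple_measure_slice n (i : 'I_n) (c : R) :
  tuple_measure n [set t : n.-tuple RT | tnth t i = c] = 0%E.
Proof.
have mS k (j : 'I_k) : measurable [set t : k.-tuple RT | tnth t j = c].
  have := @measurable_tnth _ RT k j measurableT [set c] (@measurable_set1 R c).
  by rewrite setTI.
have nS k (j : 'I_k) :
    nnm (fun t => (\1_[set t : k.-tuple RT | tnth t j = c] t)%:E : \bar R).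
  by apply: nnm_EFin => [|t] //; apply: measurable_indic; exact: mS.
suff : (\int[tuple_measure n]_t (\1_[set t : n.-tuple RT | tnth t i = c] t)%:E = 0)%E.
  by rewrite (integral_indic _ measurableT (mS _ i)) setIT.
elim: n i => [[]//|n IH] i.
rewrite (tuple_measureS (nS _ i)).
case: (unliftP ord0 i) => [j ->|->].
  rewrite integral0_eq// => x _; rewrite -[RHS](IH j); apply: eq_integral => t _.
  by rewrite !indicE; congr ((nat_of_bool _)%:R%:E); apply/idP/idP; rewrite !inE/= /tcons/= tnthS.
pose h (x : RT) := (\int[tuple_measure n]_t ((\1_[set c] x)%:E : \bar R))%E.
transitivity (\int[mu]_x h x)%E.
  apply: eq_integral => x _; apply: eq_integral => t _.
  by rewrite !indicE; congr ((nat_of_bool _)%:R%:E); apply/idP/idP; rewrite !inE/= /tcons/= tnth0.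
transitivity (\int[mu]_(x in [set c]) h x)%E; last by rewrite integral_set1.
rewrite [RHS]integral_mkcond; apply: eq_integral => x _; rewrite patchE.
case: ifPn => // xc; rewrite /h indicE (negbTE xc).
by rewrite integral0_eq.
Qed.

Lemma enorm_ge0 n (x : n.-tuple R) : 0 <= enorm x.
Proof. exact: sqrtr_ge0. Qed.

Lemma normr_tnth_le_enorm n (x : n.-tuple R) i : `|tnth x i| <= enorm x.
Proof.
rewrite /enorm -sqrtr_sqr ler_wsqrtr// (bigD1 i)//= lerDl.
by apply: sumr_ge0 => j _; exact: sqr_ge0.
Qed.

Definition riesz_kernel n (a sig : R) (z : n.-tuple RT * n.-tuple RT) : R :=
  (enorm (tsub z.1 z.2) `^ (n%:R - a) * enorm z.2 `^ sig)^-1.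

Lemma measurable_enorm n : measurable_fun setT (fun x : n.-tuple RT => enorm x).
Proof.
apply: (@measurableT_comp _ _ _ _ _ _ (@Num.sqrt R)).
  by apply: continuous_measurable_fun; exact: sqrt_continuous.
apply: measurable_sum => i.
apply: measurable_funX; exact: measurable_tnth.
Qed.

Lemma measurable_tsub n :
  measurable_fun setT (fun z : n.-tuple RT * n.-tuple RT => tsub z.1 z.2 : n.-tuple RT).
Proof.
apply/measurable_fun_tnthP => i.
rewrite (_ : _ \o _ = fun z : n.-tuple RT * n.-tuple RT =>
   (tnth z.1 i : R) - (tnth z.2 i : R)).
  apply: measurable_funB.
    exact: (measurableT_comp (measurable_tnth i) measurable_fst).
  exact: (measurableT_comp (measurable_tnth i) measurable_snd).
by apply/funext => z /=; rewrite tnth_mktuple.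
Qed.

Lemma nnm_riesz_kernel n (a sig : R) : nnm (fun z => (@riesz_kernel n a sig z)%:E).
Proof.
apply: nnm_EFin => [|z]; last by rewrite invr_ge0 mulr_ge0 ?powR_ge0.
rewrite (_ : @riesz_kernel n a sig = fun z => (enorm (tsub z.1 z.2) `^ (n%:R - a) * enorm z.2 `^ sig) `^ (-1)).
  apply: measurable_powR_comp; apply: measurable_funM; apply: measurable_powR_comp.
    exact: (measurableT_comp (@measurable_enorm n) (@measurable_tsub n)).
  exact: (measurableT_comp (@measurable_enorm n) measurable_snd).
by apply/funext => z; rewrite powR_inv1// mulr_ge0 ?powR_ge0.
Qed.

Lemma riesz_kernel_le n (a sig : R) (x y : n.+1.-tuple RT) :
  a <= n.+1%:R -> 0 <= sig ->
  (forall i, tnth y i != tnth x i) -> (forall i, tnth y i != 0 :> R) ->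
  riesz_kernel a sig (x, y) <=
  riesz_prod ((n.+1%:R - a) / n.+1%:R) (sig / n.+1%:R) (x, y).
Proof.
move=> an sig0 yx y0; set N : R := n.+1%:R.
have N0 : 0 < N by rewrite ltr0n.
have main (z : n.+1.-tuple R) e : 0 <= e -> (forall i, tnth z i != 0) ->
    0 < \prod_(i < n.+1) `|tnth z i| `^ (e / N) <= enorm z `^ e.
  move=> e0 z0; apply/andP; split.
    by apply: prodr_gt0 => i _; rewrite powR_gt0// normr_gt0.
  have -> : enorm z `^ e = \prod_(i < n.+1) enorm z `^ (e / N).
    rewrite prodr_const card_ord -powR_mulrn ?powR_ge0// -powRrM divfK//.
    by rewrite gt_eqF.
  apply: ler_prod => i _; rewrite powR_ge0/= ge0_ler_powR ?nnegrE ?enorm_ge0//.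
    by rewrite divr_ge0// ltW.
  exact: normr_tnth_le_enorm.
have na0 : 0 <= N - a by rewrite subr_ge0.
have d0 i : tnth (tsub x y) i != 0.
  by rewrite tnth_mktuple subr_eq0 eq_sym.
have /andP[A0 A1] := main (tsub x y) _ na0 d0.
have /andP[B0 B1] := main y _ sig0 y0.
rewrite /riesz_kernel /riesz_prod /riesz1 /= big_split/=.
have -> : \prod_(i < n.+1) `|tnth x i - tnth y i| `^ (- ((N - a) / N)) =
    (\prod_(i < n.+1) `|tnth (tsub x y) i| `^ ((N - a) / N))^-1.
  by rewrite -prodfV; apply: eq_bigr => i _; rewrite powRN tnth_mktuple.
have -> : \prod_(i < n.+1) `|tnth y i| `^ (- (sig / N)) =
    (\prod_(i < n.+1) `|tnth y i| `^ (sig / N))^-1.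
  by rewrite -prodfV; apply: eq_bigr => i _; rewrite powRN.
rewrite -invfM lef_pV2 ?posrE ?mulr_gt0 ?(lt_le_trans A0 A1) ?(lt_le_trans B0 B1)//.
by apply: ler_pM; [exact: ltW|exact: ltW|exact: A1|exact: B1].
Qed.

Lemma ae_tuple_measure_neq n (c : 'I_n -> R) :
  {ae tuple_measure n, forall y : n.-tuple RT, forall i, tnth y i != c i :> R}.
Proof.
apply: filter_forall => i; exists [set t : n.-tuple RT | tnth t i = c i]; split.
- have := @measurable_tnth _ RT n i measurableT [set c i] (@measurable_set1 R (c i)).
  by rewrite setTI.
- exact: tuple_measure_slice.
- by move=> y /= /negP; rewrite negbK => /eqP.
Qed.

Lemma intop_riesz_kernel_le n (a sig : R) (g : n.+1.-tuple RT -> \bar R) x :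
  a <= n.+1%:R -> 0 <= sig -> nnm g ->
  (intop (tuple_measure n.+1) (fun z => (riesz_kernel a sig z)%:E) g x <=
   intop (tuple_measure n.+1)
     (fun z => (riesz_prod ((n.+1%:R - a) / n.+1%:R) (sig / n.+1%:R) z)%:E) g x)%E.
Proof.
move=> an sig0 ng; have [_ g0] := ng.
have [m1 p1] := nnmM (nnm_section x (@nnm_riesz_kernel n.+1 a sig)) ng.
have [m2 p2] := nnmM (nnm_section x
  (nnm_riesz_prod ((n.+1%:R - a) / n.+1%:R) (sig / n.+1%:R) n.+1)) ng.
apply: ae_ge0_le_integral => //.
have := ae_tuple_measure_neq (fun i => tnth x i).
have := @ae_tuple_measure_neq n.+1 (fun _ => 0).
apply: filterS2 => y y0 yx _; rewrite lee_wpmul2r// lee_fin.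
exact: riesz_kernel_le.
Qed.

(** With N the dimension, L^(N/X) is dual to L^P for 1/P = 1 - X/N. Then X > 0 gives P > 1, sig < a
    gives lam + tau < 1, and X < N - a is exactly the Hardy condition, since tau + 1/m = (X +
    a)/N. *)
Lemma riesz_kernel_operator_bound n (a sig X : R) :
  0 < a -> a < n.+1%:R -> 0 <= sig -> sig < a -> 0 < X -> X < n.+1%:R - a ->
  exists2 C, 0 <= C & operator_bound (tuple_measure n.+1)
    (fun z => (riesz_kernel a sig z)%:E) (n.+1%:R / (X + (a - sig))) (n.+1%:R / X) C.
Proof.
move=> a0 an sig0 siga X0 Xna; set N : R := n.+1%:R.
have N0 : 0 < N by rewrite ltr0n.
have NN0 : N != 0 by rewrite gt_eqF.
pose P := (1 - X / N)^-1; pose m := N / (X + (a - sig)); pose r := N / X.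
have XltN : X < N by move: Xna; rewrite -/N; lra.
have XsN : X + (a - sig) < N by move: Xna; rewrite -/N; lra.
have Xs0 : 0 < X + (a - sig) by lra.
have XN : X / N < 1 by rewrite ltr_pdivrMr// mul1r.
have XN0 : 0 < X / N by rewrite divr_gt0.
have iP0 : 0 < 1 - X / N by rewrite subr_gt0.
have PV : P^-1 = 1 - X / N by rewrite /P invrK.
have P1 : 1 < P by rewrite /P invf_gt1 ?posrE// gtrBl.
have mV : m^-1 = (X + (a - sig)) / N by rewrite /m invf_div.
have rV : r^-1 = X / N by rewrite /r invf_div.
have m1 : 1 < m by rewrite /m ltr_pdivlMr// mul1r.
pose lam := (N - a) / N; pose tau := sig / N.
have lam0 : 0 < lam by rewrite divr_gt0// subr_gt0.
have tau0 : 0 <= tau by rewrite divr_ge0// ltW.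
have sE : P^-1 + m^-1 + lam + tau = 2 by rewrite PV mV /lam /tau; field.
have lt1 : lam + tau < 1 by rewrite -mulrDl ltr_pdivrMr// mul1r; lra.
have tm : tau + m^-1 < 1.
  by rewrite mV -mulrDl ltr_pdivrMr// mul1r; move: Xna; rewrite -/N; lra.
have [C C0 B] := riesz1_bilinear_bound P1 m1 sE lam0 tau0 lt1 tm.
have P0 : 0 < P by lra.
have m0 : 0 < m by lra.
have Bn := riesz_prod_bilinear_bound (n := n.+1) P0 m0 C0 B.
exists (C ^+ n.+1); first exact: exprn_ge0.
have Pr : P^-1 + r^-1 = 1 by rewrite PV rV subrK.
have O := operator_bound_of_bilinear P1 Pr (exprn_ge0 n.+1 C0) (nnm_riesz_prod lam tau n.+1) Bn.
move=> g ng; apply: le_trans (O g ng).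
have r0 : 0 < r by rewrite divr_gt0.
have nK := @nnm_riesz_kernel n.+1 a sig.
have nK' := nnm_riesz_prod lam tau n.+1.
apply: le_poweR; first by rewrite invr_ge0 ltW.
  by apply: nnm_integral_ge0; apply: nnm_poweR; exact: nnm_intop.
apply: nnm_le_integral; [by apply: nnm_poweR; exact: nnm_intop|by apply: nnm_poweR; exact: nnm_intop|].
move=> x; apply: le_poweR; first exact: ltW.
  by case: (nnm_intop (tuple_measure n.+1) nK ng).
by apply: intop_riesz_kernel_le => //; exact: ltW.
Qed.

Lemma whlsE n (a sig e : R) (g : n.-tuple RT -> R) x :
  measurable_fun setT g -> (forall y, 0 < g y) ->
  whls a sig e g x = intop (tuple_measure n) (fun z => (riesz_kernel a sig z)%:E)
    (fun y => (g y)%:E `^ e)%E x.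
Proof.
move=> mg g0; have ng := nnm_poweR e (nnm_EFin mg (fun y => ltW (g0 y))).
rewrite /intop tuple_measureE; last first.
  exact: (nnmM (nnm_section x (@nnm_riesz_kernel n a sig)) ng).
rewrite /whls; congr intRn; apply/funext => y.
by rewrite poweR_EFin -EFinM mulrC.
Qed.

Lemma inLpE n (r : R) (f : n.-tuple RT -> R) : (forall y, 0 < f y) ->
  inLp r f <->
  (measurable_fun setT f /\ (\int[tuple_measure n]_x (f x)%:E `^ r < +oo)%E).
Proof.
move=> f0; have E : (fun x => (`|f x| `^ r)%:E) = (fun x => (f x)%:E `^ r)%E.
  by apply/funext => x; rewrite gtr0_norm.
rewrite /inLp E; split=> -[mf I]; split=> //; move: I;
  by rewrite (tuple_measureE (nnm_poweR r (nnm_EFin mf (fun y => ltW (f0 y))))).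
Qed.

End RieszKernel.

(** * Exponents *)

Section Exponents.
Context {R : realType}.
Implicit Types (a p q N : R).

Lemma pq_minus1_gt0 (p q : R) : 1 < p -> p <= q -> 0 < p * q - 1.
Proof. by move=> p1 pq; nra. Qed.

(** The pair (q0, p0) is the scaling exponent of the system, the unique solution (X, Y) of p X = Y +
    (a - s2) and q Y = X + (a - s1). *)
Lemma p0_scaling (a s1 s2 p q : R) : p * q - 1 != 0 ->
  p * q0 a s1 s2 p q = p0 a s1 s2 p q + (a - s2).
Proof. by move=> h; rewrite /p0 /q0; field. Qed.

Lemma q0_scaling (a s1 s2 p q : R) : p * q - 1 != 0 ->
  q * p0 a s1 s2 p q = q0 a s1 s2 p q + (a - s1).
Proof. by move=> h; rewrite /p0 /q0; field. Qed.

Lemma p0_gt0 (a s1 s2 p q : R) : s1 < a -> s2 < a -> 1 < p -> p <= q ->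
  0 < p0 a s1 s2 p q.
Proof.
move=> h1 h2 p1 pq; rewrite /p0 divr_gt0 ?pq_minus1_gt0//.
have : 0 < (a - s1) * p by rewrite mulr_gt0; lra.
lra.
Qed.

Lemma q0_gt0 (a s1 s2 p q : R) : s1 < a -> s2 < a -> 1 < p -> p <= q ->
  0 < q0 a s1 s2 p q.
Proof.
move=> h1 h2 p1 pq; rewrite /q0 divr_gt0 ?pq_minus1_gt0//.
have : 0 < (a - s2) * q by rewrite mulr_gt0; lra.
lra.
Qed.

(** The numerator of q0 - p0 is (a - s2)(q - 1) - (a - s1)(p - 1). *)
Lemma p0_le_q0 (a s1 s2 p q : R) : s1 < a -> s2 < a -> 1 < p -> p <= q -> s2 <= s1 ->
  p0 a s1 s2 p q <= q0 a s1 s2 p q.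
Proof.
move=> h1 h2 p1 pq s21; rewrite /p0 /q0 ler_pM2r ?invr_gt0 ?pq_minus1_gt0//.
have : (a - s1) * (p - 1) <= (a - s2) * (q - 1) by apply: ler_pM; lra.
lra.
Qed.

End Exponents.

(** * Integrability through a single equation *)

Section PowerIntegrability.
Local Open Scope ereal_scope.
Context {R : realType} d (T : measurableType d).
Variable mu : {sigma_finite_measure set T -> \bar R}.

Lemma intop_power_integrable (K : T * T -> \bar R) (f g : T -> R) (e M X N C : R) :
  measurable_fun setT g -> (forall x, (0 < g x)%R) -> (0 < N)%R -> (0 < e)%R ->
  (0 < M)%R -> (0 < X)%R -> (0 <= C)%R ->
  operator_bound mu K (N / M) (N / X) C ->
  (forall x, (f x)%:E = intop mu K (fun y => (g y)%:E `^ e) x) ->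
  \int[mu]_x (g x)%:E `^ (N / (M / e)) < +oo ->
  \int[mu]_x (f x)%:E `^ (N / X) < +oo.
Proof.
move=> mg g0 N0 e0 M0 X0 C0 O fE Ig.
have ng := nnm_poweR e (nnm_EFin mg (fun y => ltW (g0 y))).
have NX : (N / X != 0)%R by rewrite gt_eqF// divr_gt0.
have NM : (N / M != 0)%R by rewrite gt_eqF// divr_gt0.
under eq_integral do rewrite fE.
rewrite -(lpn_lty mu _ NX); apply: (le_lt_trans (O _ ng)).
apply: lte_mul_pinfty; [by rewrite lee_fin|by []|].
rewrite (lpn_lty mu _ NM).
rewrite (eq_integral (fun x => (g x)%:E `^ (N / (M / e))))// => x _.
by rewrite -poweRrM; congr (_ `^ _)%E; rewrite invf_div; ring.
Qed.

End PowerIntegrability.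

Theorem theorem3p2 (R : realType) (n : nat) (a s1 s2 p q : R)
  (u v : n.-tuple R -> R) :
  (3 <= n)%N ->
  0 < a -> a < n%:R ->
  0 <= s1 -> s1 < a -> 0 <= s2 -> s2 < a ->
  1 < p -> p <= q -> s2 <= s1 ->
  q0 a s1 s2 p q + p0 a s1 s2 p q <= n%:R - a ->
  (* positive solutions of the integral system *)
  (forall x, 0 < u x) -> (forall x, 0 < v x) ->
  (forall x, (u x)%:E = whls a s1 q v x) ->
  (forall x, (v x)%:E = whls a s2 p u x) ->
  (* integrability: u in L^{r0}, v in L^{s0} *)
  inLp (n%:R / q0 a s1 s2 p q) u ->
  inLp (n%:R / p0 a s1 s2 p q) v ->
  forall r s : R,
    0 < r^-1 -> r^-1 < (n%:R - a) / n%:R ->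
    0 < s^-1 -> s^-1 < Num.min ((n%:R - a) / n%:R) ((p * (n%:R - a) - (a - s2)) / n%:R) ->
    inLp r u /\ inLp s v.
Proof.
case: n u v => [//|n] u v _ a0 an s10 s1a s20 s2a p1 pq s21 PQ u0 v0 uE vE.
move=> /(inLpE _ u0)[mu Iu0] /(inLpE _ v0)[mv Iv0] r s r0 rN s0 sN.
suff [Iu Iv] : ((\int[tuple_measure n.+1]_x (u x)%:E `^ r < +oo) /\
    (\int[tuple_measure n.+1]_x (v x)%:E `^ s < +oo))%E by split; apply/inLpE.
have p_0 : 0 < p by lra.
have q1 : 1 < q by lra.
have q_0 : 0 < q by lra.
have pq1 : p * q - 1 != 0 by rewrite gt_eqF// pq_minus1_gt0.
have pE := p0_scaling a s1 s2 pq1; have qE := q0_scaling a s1 s2 pq1.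
have p00 := p0_gt0 s1a s2a p1 pq; have q00 := q0_gt0 s1a s2a p1 pq.
have p0q0 := p0_le_q0 s1a s2a p1 pq s21.
move: PQ Iu0 Iv0 pE qE p00 q00 p0q0.
set P0 := p0 _ _ _ _ _; set Q0 := q0 _ _ _ _ _; set N : R := n.+1%:R.
clearbody P0 Q0 => PQ Iu0 Iv0 pE qE p00 q00 p0q0.
have N0 : 0 < N by rewrite ltr0n.
set nu := tuple_measure n.+1 in Iu0 Iv0 *.
pose K sig (z : n.+1.-tuple (measurableTypeR R) * n.+1.-tuple (measurableTypeR R)) :=
  (riesz_kernel a sig z)%:E.
have nK sig : nnm (K sig) by exact: nnm_riesz_kernel.
have {}uE x : (u x)%:E = intop nu (K s1) (fun y => (v y)%:E `^ q)%E x by rewrite uE whlsE.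
have {}vE x : (v x)%:E = intop nu (K s2) (fun y => (u y)%:E `^ p)%E x by rewrite vE whlsE.
have O1 X : 0 < X -> X < N - a ->
    exists2 C, 0 <= C & operator_bound nu (K s1) (N / (X + (a - s1))) (N / X) C.
  by move=> X0 XN; exact: riesz_kernel_operator_bound.
have O2 X : 0 < X -> X < N - a ->
    exists2 C, 0 <= C & operator_bound nu (K s2) (N / (X + (a - s2))) (N / X) C.
  by move=> X0 XN; exact: riesz_kernel_operator_bound.
clearbody K nu; clear s10 s20.
have Q0N : Q0 < N - a by lra.
have P0N : P0 < N - a by lra.
have u_lift X : Q0 - P0 < X -> X < N - a -> (\int[nu]_x (u x)%:E `^ (N / X) < +oo)%E.
  move=> QX XN; pose Y := X - (Q0 - P0).
  (* Y is the exponent of K2 (u^(p-1) w) for w of exponent X, and X > Q0 - P0 is its positivity. For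
     X = Q0 it equals P0, the second pair used by the lifting. *)
  have X0 : 0 < X by lra.
  have Y0 : 0 < Y by rewrite /Y; lra.
  have YN : Y < N - a by rewrite /Y; lra.
  have [C1 C1_0 B1] := O1 X X0 XN.
  have [C10 C10_0 B10] := O1 Q0 q00 Q0N.
  have [C2 C2_0 B2] := O2 Y Y0 YN.
  have [C20 C20_0 B20] := O2 P0 p00 P0N.
  have ge1 Z : 0 < Z -> Z < N - a -> 1 <= N / Z.
    by move=> Z0 ZN; rewrite ler_pdivlMr// mul1r; lra.
  have NN0 : N != 0 by rewrite gt_eqF.
  have gt0 Z : 0 < Z -> 0 < N / Z by move=> Z0; rewrite divr_gt0.
  have e1 : 0 < X + (a - s1) by lra.
  have e2 : 0 < Q0 + (a - s1) by lra.
  have e3 : 0 < Y + (a - s2) by lra.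
  have e4 : 0 < P0 + (a - s2) by lra.
  have h1 : q * P0 - P0 + Y = X + (a - s1) by rewrite qE /Y; lra.
  have h2 : q * P0 - P0 + P0 = Q0 + (a - s1) by rewrite qE; lra.
  have h3 : p * Q0 - Q0 + X = Y + (a - s2) by rewrite pE /Y; lra.
  have h4 : p * Q0 - Q0 + Q0 = P0 + (a - s2) by rewrite pE; lra.
  have hold (t A Z M : R) : 0 < A -> 0 < Z -> 0 < M -> t * A - A + Z = M ->
      (N / M)^-1 = (t - 1) / (N / A) + (N / Z)^-1.
    by move=> A0 Z0 M0 <-; rewrite !invf_div mulrA -mulrDl; congr (_ / _); ring.
  exact: (integral_system_lifting (nK s1) (nK s2) mu mv u0 v0 p1 q1 uE vE
    (ge1 _ q00 Q0N) (ge1 _ X0 XN) (gt0 _ p00) (gt0 _ Y0)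
    (gt0 _ e1) (gt0 _ e2) (gt0 _ e3) (gt0 _ e4)
    (hold _ _ _ _ p00 Y0 e1 h1) (hold _ _ _ _ p00 p00 e2 h2)
    (hold _ _ _ _ q00 X0 e3 h3) (hold _ _ _ _ q00 q00 e4 h4)
    C1_0 C10_0 C2_0 C20_0 B1 B10 B2 B20 Iu0 Iv0).
have v_all Y : 0 < Y -> Y < N - a -> Y < p * (N - a) - (a - s2) ->
    (\int[nu]_x (v x)%:E `^ (N / Y) < +oo)%E.
  move=> Y0 YN Yp; have [C C0 B] := O2 Y Y0 YN.
  have M0 : 0 < Y + (a - s2) by lra.
  (* The exponent of u is X = (Y + (a - s2))/p. The bound X < N - a is the origin of the second
     entry of the minimum; X > Q0 - P0 amounts to P0 < Y + p P0. *)
  apply: (intop_power_integrable mu u0 N0 p_0 M0 Y0 C0 B vE); apply: u_lift.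
    rewrite ltr_pdivlMr// mulrC mulrBr pE.
    have : P0 < p * P0 by rewrite ltr_pMl.
    lra.
  by rewrite ltr_pdivrMr// [_ * p]mulrC; lra.
have u_all X : 0 < X -> X < N - a -> (\int[nu]_x (u x)%:E `^ (N / X) < +oo)%E.
  move=> X0 XN; have [QX|XQ] := ltP (Q0 - P0) X; first exact: u_lift.
  have [C C0 B] := O1 X X0 XN; have M0 : 0 < X + (a - s1) by lra.
  apply: (intop_power_integrable mv v0 N0 q_0 M0 X0 C0 B uE).
  (* X <= Q0 - P0 < Q0 pushes the exponent of v below P0. This is admissible for [v_all] because P0
     < N - a and P0 = p Q0 - (a - s2) with Q0 < N - a. *)
  have YP : (X + (a - s1)) / q < P0.
    by rewrite ltr_pdivrMr// [_ * q]mulrC qE; lra.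
  apply: v_all; first by rewrite divr_gt0.
    exact: lt_trans P0N.
  apply: (lt_trans YP); have : p * Q0 < p * (N - a) by rewrite ltr_pM2l.
  by rewrite pE; lra.
have inv_arg (t : R) : 0 < t^-1 -> t = N / (N * t^-1).
  move=> t0; have tN0 : t != 0 by rewrite -invr_eq0 gt_eqF.
  by field; rewrite tN0 gt_eqF.
have bound (t B : R) : t^-1 < B / N -> N * t^-1 < B.
  by move=> h; rewrite mulrC -ltr_pdivlMr.
move: sN; rewrite lt_min => /andP[sN sN'].
split.
  rewrite (inv_arg r r0); apply: u_all; first by rewrite mulr_gt0.
  exact: bound.
rewrite (inv_arg s s0); apply: v_all; first by rewrite mulr_gt0.
  exact: bound.
exact: bound.
Qed.
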